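(* The two indices $\mu_{RS}$ and $\mu_{RS2}$ coincide on symplectic shears: if $B:[0,1]\to\mathrm{Mat}(n\times n,\mathbb{R})$ is a continuous path of symmetric matrices and $\psi_t=\begin{pmatrix}\mathrm{Id}&B(t)\\0&\mathrm{Id}\end{pmatrix}$ for $t\in[0,1]$, then $\mu_{RS}(\psi)=\mu_{RS2}(\psi)$.
   Context: $\mathrm{Sp}(\mathbb{R}^{2n},\Omega_0)=\{A : A^\tau\Omega_0A=\Omega_0\}$ with $\Omega_0=\begin{pmatrix}0&\mathrm{Id}\\-\mathrm{Id}&0\end{pmatrix}$. $\mathrm{Sign}$ of a symmetric form is the number of positive minus the number of negative eigenvalues. Robbin-Salamon index of a path of Lagrangians. Let $(E,\omega)$ be a symplectic vector space of dimension $2m$, and $\mathcal{L}_m$ its space of Lagrangian subspaces. For a smooth curve $\Lambda:[a,b]\to\mathcal{L}_m$ and $t_0\in[a,b]$, choose a Lagrangian complement $W$ of $\Lambda_{t_0}$; for $t$ near $t_0$, $\Lambda_t=\{v+\alpha_t(v): v\in\Lambda_{t_0}\}$ with $\alpha_t:\Lambda_{t_0}\to W$ linear, and $Q(\Lambda_{t_0},\dot\Lambda_{t_0})(v,v')=\frac{d}{dt}\big|_{t_0}\omega(v,\alpha_t(v'))$, a symmetric bilinear form on $\Lambda_{t_0}$ independent of $W$. Fix a reference Lagrangian $L$. A crossing is a $t$ with $\Lambda_t\cap L\ne\{0\}$; its crossing form is $\Gamma(\Lambda,L,t)=Q(\Lambda_t,\dot\Lambda_t)|_{\Lambda_t\cap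 L}$, and the crossing is regular if this form is nondegenerate. If $\Lambda$ has only regular crossings, $\mu_{RS}(\Lambda,L)=\frac12\mathrm{Sign}\,\Gamma(\Lambda,L,a)+\sum_{a<t<b,\ t\text{ crossing}}\mathrm{Sign}\,\Gamma(\Lambda,L,t)+\frac12\mathrm{Sign}\,\Gamma(\Lambda,L,b)$ (an end term is $0$ if the endpoint is not a crossing). For a continuous path, $\mu_{RS}(\Lambda,L)$ is the value on any smooth path with only regular crossings homotopic to $\Lambda$ with fixed endpoints (Robbin and Salamon: such paths exist and the value does not depend on the choice). For a continuous path $\psi:[0,1]\to\mathrm{Sp}(\mathbb{R}^{2n},\Omega_0)$: $\mu_{RS}(\psi):=\mu_{RS}(\mathrm{Gr}\,\psi,\Delta)$, computed in $(\mathbb{R}^{2n}\times\mathbb{R}^{2n},\overline\Omega=-\Omega_0\oplus\Omega_0)$, with $\mathrm{Gr}\,\psi_t=\{(x,\psi_tx)\}$ and $\Delta=\{(x,x)\}$; and $\mu_{RS2}(\psi):=\mu_{RS}(\psi V,V)$, computed in $(\mathbb{R}^{2n},\Omega_0)$, where $V=\{0\}\times\mathbb{R}^n$ and $\psi V$ is the path $t\mapsto\psi_tV$. *)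

(* Defs.v *)
(* MathComp + MathComp-Analysis *)
From HB Require Import structures.
From mathcomp Require Import all_boot all_order all_algebra.
From mathcomp Require Import all_classical all_reals all_analysis.
Import Order.TTheory GRing.Theory Num.Theory.
Import numFieldNormedType.Exports.

Set Implicit Arguments.
Unset Strict Implicit.
Unset Printing Implicit Defensive.

Local Open Scope classical_set_scope.
Local Open Scope ring_scope.

(* Paths are total functions on R of which only the values on a set D, usually
   `[a, b], matter; all limits are taken within D.                            *)

Section Calculus.
Context {R : realType}.

Definition smooth (V : normedModType R) (g : R -> V) : Prop :=
  forall (k : nat) (t : R), derivable (derive1n k g) t 1.

(* Smoothness on a subset of R, near one of its points, in the sense of local
   extendability; this includes the endpoints of a closed interval.           *)
Definition smooth_within_at (V : normedModType R) (D : set R) (f : R -> V)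
    (t0 : R) : Prop :=
  exists2 g : R -> V, smooth g & \forall t \near within D (nbhs t0), f t = g t.

(* One-sided at an endpoint of D. *)
Definition derive_within (D : set R) (f : R -> R) (t0 : R) : R :=
  lim ((f t - f t0) / (t - t0) @[t --> within D t0^']).

End Calculus.

Section SymmetricForms.
Context {R : realType}.

(* Eigenvalues are counted with (algebraic) multiplicity. *)
Definition mx_signature (k : nat) (M : 'M[R]_k) : int :=
  \sum_(a \in [set a : R | 0 < a]) (mup a (char_poly M))%:Z
  - \sum_(a \in [set a : R | a < 0]) (mup a (char_poly M))%:Z.

Context {E : vectType R}.

(* The eigenvalues of a form on the subspace K are those of its Gram matrix in
   a basis of K; by Sylvester's law the number of positive ones and the number
   of negative ones do not depend on the basis.                               *)
Definition gram (K : {vspace E}) (q : E -> E -> R) : 'M[R]_(\dim K) :=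
  \matrix_(i, j) q (vbasis K)`_i (vbasis K)`_j.

Definition signature (K : {vspace E}) (q : E -> E -> R) : int :=
  mx_signature (gram K q).

Definition nondegenerate_on (K : {vspace E}) (q : E -> E -> R) : Prop :=
  forall v, v \in K -> (forall v', v' \in K -> q v v' = 0) -> v = 0.

End SymmetricForms.

Section Lagrangians.
Context {R : realType} {N : nat}.
Local Notation E := 'cV[R]_N.
(* Gram matrix of the symplectic form of E in the standard basis *)
Variable Om : 'M[R]_N.

Definition sform (u v : E) : R := (u^T *m Om *m v) 0 0.

Definition lagrangian (L : {vspace E}) : Prop :=
  (forall u v, u \in L -> v \in L -> sform u v = 0) /\ (\dim L).*2 = N.

Definition lagrangian_complement (L W : {vspace E}) : Prop :=
  [/\ lagrangian W, (L + W)%VS = fullv & (L :&: W)%VS = 0%VS].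

(* For x in D near x0, F x = {v + al x v : v in F x0} with al x : F x0 -> W.
   The values of al x outside F x0 are irrelevant.                            *)
Definition graph_chart (X : topologicalType) (D : set X) (F : X -> {vspace E})
    (x0 : X) (W : {vspace E}) (al : X -> 'End(E)) : Prop :=
  \forall x \near within D (nbhs x0),
    (al x @: F x0 <= W)%VS /\ F x = ((\1 + al x)%VF @: F x0)%VS.

(* Continuity and smoothness of maps to the Lagrangian Grassmannian, whose
   charts at L0 are the L = {v + al v : v in L0} |-> al, for the Lagrangian
   complements W of L0.                                                       *)
Definition lagrangian_continuous (X : topologicalType) (D : set X)
    (F : X -> {vspace E}) : Prop :=
  forall x0, D x0 -> lagrangian (F x0) /\
    exists W al, [/\ lagrangian_complement (F x0) W,
      graph_chart D F x0 W al &
      forall v, v \in F x0 ->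
        al x v @[x --> within D (nbhs x0)] --> (al x0 v : E)].

Definition lagrangian_smooth (D : set R) (Lam : R -> {vspace E}) : Prop :=
  forall t0, D t0 -> lagrangian (Lam t0) /\
    exists W al, [/\ lagrangian_complement (Lam t0) W,
      graph_chart D Lam t0 W al &
      forall v, v \in Lam t0 ->
        smooth_within_at D (fun t => al t v : E) t0].

(* Q(Lam_t0, Lam'_t0)(v, v'), meaningful for v, v' in Lam t0; for a smooth
   curve the set below is a singleton (W is arbitrary).                       *)
Definition velocity_form (D : set R) (Lam : R -> {vspace E}) (t0 : R)
    (v v' : E) : R :=
  get [set q : R | exists W al, [/\ lagrangian_complement (Lam t0) W,
    graph_chart D Lam t0 W al &
    q = derive_within D (fun t => sform v (al t v')) t0]].

Definition crossing (Lam : R -> {vspace E}) (L : {vspace E}) (t : R) : Prop :=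
  (Lam t :&: L)%VS <> 0%VS.

Definition regular_crossing (D : set R) (Lam : R -> {vspace E})
    (L : {vspace E}) (t : R) : Prop :=
  crossing Lam L t /\
  nondegenerate_on (Lam t :&: L)%VS (velocity_form D Lam t).

(* Sign of the crossing form; it is 0 if t is not a crossing. *)
Definition crossing_sign (D : set R) (Lam : R -> {vspace E}) (L : {vspace E})
    (t : R) : int :=
  signature (Lam t :&: L)%VS (velocity_form D Lam t).

(* The sum over the interior crossings is a finite-support sum; regular
   crossings are isolated, so there are finitely many of them in `[a, b].     *)
Definition crossing_sum (a b : R) (Lam : R -> {vspace E}) (L : {vspace E}) :
    rat :=
  let sgn t := (crossing_sign `[a, b]%classic Lam L t)%:Q in
  sgn a / 2
  + \sum_(t \in [set t | a < t < b /\ crossing Lam L t]) sgn t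
  + sgn b / 2.

Definition homotopic_rel_endpoints (a b : R) (Lam Lam' : R -> {vspace E}) :
    Prop :=
  exists H : R * R -> {vspace E},
    [/\ lagrangian_continuous ([set` `[0, 1]] `*` [set` `[a, b]] : set (R * R)) H,
        forall t, t \in `[a, b] -> H (0, t) = Lam t,
        forall t, t \in `[a, b] -> H (1, t) = Lam' t &
        forall s, s \in `[0, 1] -> H (s, a) = Lam a /\ H (s, b) = Lam b].

(* The set below is a singleton for every continuous path Lam of Lagrangian
   subspaces, by Robbin and Salamon, so the default value 0 is immaterial.    *)
Definition rs_index (a b : R) (Lam : R -> {vspace E}) (L : {vspace E}) : rat :=
  xget 0 [set k : rat | exists Lam' : R -> {vspace E},
    [/\ lagrangian_smooth `[a, b]%classic Lam',
        forall t, t \in `[a, b] -> crossing Lam' L t ->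
          regular_crossing `[a, b]%classic Lam' L t,
        homotopic_rel_endpoints a b Lam Lam' &
        k = crossing_sum a b Lam' L]].

End Lagrangians.

Section SymplecticPaths.
Context {R : realType} {n : nat}.

Definition Omega0 : 'M[R]_(n + n) := block_mx 0 1%:M (- 1%:M) 0.

Definition Omega_bar : 'M[R]_((n + n) + (n + n)) :=
  block_mx (- Omega0) 0 0 Omega0.

Definition mxgraph (A : 'M[R]_(n + n)) : {vspace 'cV[R]_((n + n) + (n + n))} :=
  limg (linfun (fun x : 'cV[R]_(n + n) => col_mx x (A *m x))).

Definition diagonal_space : {vspace 'cV[R]_((n + n) + (n + n))} :=
  limg (linfun (fun x : 'cV[R]_(n + n) => col_mx x x)).

(* {0} x R^n *)
Definition vertical : {vspace 'cV[R]_(n + n)} :=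
  lker (linfun (fun x : 'cV[R]_(n + n) => usubmx x)).

Definition mu_RS (psi : R -> 'M[R]_(n + n)) : rat :=
  rs_index Omega_bar 0 1 (fun t => mxgraph (psi t)) diagonal_space.

Definition mu_RS2 (psi : R -> 'M[R]_(n + n)) : rat :=
  rs_index Omega0 0 1
    (fun t => (linfun (fun x : 'cV[R]_(n + n) => psi t *m x) @: vertical)%VS)
    vertical.

Definition shear (S : 'M[R]_n) : 'M[R]_(n + n) := block_mx 1%:M S 0 1%:M.

End SymplecticPaths.

(* Main.v *)
Require Import Defs.
From HB Require Import structures.
From mathcomp Require Import all_boot all_order all_algebra.
From mathcomp Require Import all_classical all_reals all_analysis.
From mathcomp Require Import zify ring lra complex.
Import Order.TTheory GRing.Theory Num.Theory.
Import numFieldNormedType.Exports.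
Set Implicit Arguments.
Unset Strict Implicit.
Unset Printing Implicit Defensive.
Local Open Scope classical_set_scope.
Local Open Scope ring_scope.

(** Both paths of Lagrangian subspaces stay transverse to one Lagrangian
    complement of their reference Lagrangian: R^n x {0} for psi V, and the graph
    of -Id for Gr psi, because -1 is not an eigenvalue of a shear. In such a
    chart a Lagrangian path is a path of symmetric matrices S_t, and its index is
    half of sign S_1 - sign S_0 ([rs_index_graph]). The two matrices are -B and
    the block sum of -B and 0 ([shear_vertical], [shear_graph]), which have the
    same signature.

    The index is defined by means of arbitrary smooth paths with regular
    crossings in the homotopy class, which may leave the chart, so the formula
    needs the homotopy invariance of the crossing sum. In Darboux coordinates
    al, be with reference Lagrangian L = ker be, the kernels W_j of al - j be are
    complements of L, and every Lagrangian subspace is transverse to one of them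
    ([transverse_exists]). For each of them it is then the graph of a map from L
    to W_j, hence has a signature; where two of these signatures are defined,
    their difference is locally constant ([chart_signature_compare]). Along a
    path they glue to an integer-valued index function, whose increment does not
    change under homotopies with fixed end points ([index_homotopy]). At a
    regular crossing the chart signature jumps by the signature of the crossing
    form ([crossing_jump]): this is perturbation theory for a symmetric matrix
    whose derivative is nondegenerate on its kernel ([mx_signature_perturb]).
    So the increment is twice the crossing sum ([crossing_count]).

    It remains to find one smooth path with regular crossings in the class. For
    large c the path S_0 + t (S_1 - S_0) + c t (1 - t) has crossings only near
    its ends, where its derivative is definite ([bulge_regular]). *)

(** * The spectral theorem for real symmetric matrices *)

Section Spectral.
Context {R : realType}.

Lemma unitmx_inj m (A : 'M[R]_m) :
  (forall x : 'cV[R]_m, A *m x = 0 -> x = 0) -> A \in unitmx.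
Proof.
move=> Ainj; rewrite -unitmx_tr -row_free_unit -kermx_eq0; apply/eqP/row_matrixP => i.
rewrite row0; apply: trmx_inj; rewrite trmx0; apply: Ainj.
apply: trmx_inj; rewrite trmx_mul trmxK trmx0 -row_mul.
by rewrite mulmx_ker row0.
Qed.

Lemma sqr_cVE m (x : 'cV[R]_m) : (x^T *m x) 0 0 = \sum_i x i 0 ^+ 2.
Proof. by rewrite mxE; apply: eq_bigr => i _; rewrite !mxE expr2. Qed.

Lemma sqr_cV_ge0 m (x : 'cV[R]_m) : 0 <= (x^T *m x) 0 0.
Proof. by rewrite sqr_cVE; apply: sumr_ge0 => i _; exact: sqr_ge0. Qed.

Lemma sqr_cV_eq0 m (x : 'cV[R]_m) : ((x^T *m x) 0 0 == 0) = (x == 0).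
Proof.
rewrite sqr_cVE psumr_eq0; last by move=> i _; exact: sqr_ge0.
apply/idP/eqP => [/allP h|->]; last first.
  by apply/allP => i _; rewrite mxE expr0n eqxx.
apply/colP => i; rewrite mxE; apply/eqP.
by have := h i (mem_index_enum _); rewrite sqrf_eq0.
Qed.

Lemma sqr_cV_gt0 m (x : 'cV[R]_m) : (0 < (x^T *m x) 0 0) = (x != 0).
Proof. by rewrite lt_def sqr_cV_ge0 sqr_cV_eq0 andbT. Qed.

(** The eigenvalues of the complexification are real because the matrix is
    Hermitian, so one of them is an eigenvalue over the reals. *)
Lemma symmetric_eigenvector m (M : 'M[R]_m.+1) : M^T = M ->
  exists a (v : 'cV[R]_m.+1), (v^T *m v) 0 0 = 1 /\ M *m v = a *: v.
Proof.
move=> Msym; pose MC := map_mx (real_complex R) M.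
have MC_herm : MC \is hermsymmx.
  apply: realsym_hermsym.
    apply/is_hermitianmxP; rewrite expr0 scale1r map_mx_id_in //.
    by rewrite /MC map_trmx Msym.
  by apply/mxOverP => i j; rewrite mxE; apply/complex_realP; exists (M i j).
have /mxOverP /(_ 0 0) /complex_realP[a aE] := hermitian_spectral_diag_real MC_herm.
have /hermitian_normalmx /orthomx_spectralP MCE := MC_herm.
set P := spectralmx MC in MCE; set d := spectral_diag MC in aE MCE.
have Punit : P \in unitmx by exact: spectral_unit.
have : eigenvalue MC (d 0 0).
  apply/eigenvalueP; exists (row 0 P).
    rewrite -row_mul {1}MCE !mulmxA mulmxV // mul1mx row_mul row_diag_mx.
    by rewrite -scalemxAl -rowE.
  by apply/negP => /eqP /(congr1 (mulmx^~ (invmx P))); rewrite -row_mul mulmxV //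
     mul0mx => /matrixP/(_ 0 0); rewrite !mxE eqxx => /eqP; rewrite oner_eq0.
rewrite eigenvalue_root_char aE -map_char_poly fmorph_root -eigenvalue_root_char.
move=> /eigenvalueP[u uM u0].
pose r := Num.sqrt ((u *m u^T) 0 0).
have u2 : (u *m u^T) 0 0 > 0.
  by have := sqr_cV_gt0 u^T; rewrite trmxK => ->; rewrite -trmx0 (inj_eq trmx_inj).
exists a, (r^-1 *: u^T); split.
  rewrite [(r^-1 *: u^T)^T]linearZ /= trmxK -scalemxAl -scalemxAr scalerA !mxE -expr2 exprVn.
  by rewrite sqr_sqrtr ?ltW // ?mxE mulVf // -?mxE ?gt_eqF //; rewrite mxE in u2.
rewrite -scalemxAr; apply: trmx_inj.
by rewrite !linearZ /= trmx_mul trmxK Msym uM !scalerA mulrC.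
Qed.

(** By induction on the size: the Householder reflection H that exchanges a unit
    eigenvector v and the first basis vector e is orthogonal and symmetric, so
    H M H splits off the eigenvalue of v and leaves a smaller symmetric block. *)
Lemma spectral_theorem m (M : 'M[R]_m) : M^T = M ->
  exists (U : 'M[R]_m) (d : 'rV[R]_m),
    U^T *m U = 1%:M /\ M = U^T *m diag_mx d *m U.
Proof.
elim: m M => [|m IHm] M Msym.
  by exists 1%:M, 0; split; rewrite [LHS]flatmx0 [RHS]flatmx0.
have [a [v [v1 Mv]]] := symmetric_eigenvector Msym.
pose e : 'cV[R]_(1 + m) := col_mx 1%:M 0.
(* If v = e then w = 0, the division gives 0, and H is the identity. *)
pose w : 'cV[R]_(1 + m) := v - e.
pose H : 'M[R]_(1 + m) := 1%:M - (2 / (w^T *m w) 0 0) *: (w *m w^T).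
have dotE (p q : 'cV[R]_(1 + m)) : p^T *m q = ((p^T *m q) 0 0)%:M.
  exact: mx11_scalar.
pose s := (w^T *m w) 0 0; pose W := w *m w^T.
have HE : H = 1%:M - (2 / s) *: W by [].
have HT : H^T = H by rewrite HE linearB /= trmx1 linearZ /= /W trmx_mul trmxK.
have Hv : H *m v = e.
  have [w0|w0] := eqVneq w 0.
    rewrite HE /W w0 mul0mx scaler0 subr0 mul1mx.
    by apply/eqP; rewrite -subr_eq0 -/w w0.
  have s0 : s != 0 by rewrite sqr_cV_eq0.
  have ve : (v^T *m e) 0 0 = (e^T *m v) 0 0 by rewrite -[e^T *m v]trmxK trmx_mul trmxK [RHS]mxE.
  have e1 : (e^T *m e) 0 0 = 1.
    by rewrite /e tr_col_mx mul_row_col trmx0 mul0mx addr0 trmx1 mul1mx mxE.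
  have sE : s = 2 * (w^T *m v) 0 0.
    have subE (A B : 'M[R]_1) : (A - B) 0 0 = A 0 0 - B 0 0 by rewrite !mxE.
    rewrite /s /w [(v - e)^T]linearB /= !mulmxBl !mulmxBr !subE v1 e1 ve; ring.
  rewrite HE mulmxBl mul1mx -scalemxAl /W -mulmxA (dotE w v) mul_mx_scalar scalerA.
  rewrite mulrAC -sE divff // scale1r /w opprB addrCA subrr addr0 //.
have HH : H *m H = 1%:M.
  have [w0|w0] := eqVneq w 0.
    by rewrite HE /W w0 mul0mx scaler0 subr0 mul1mx.
  have s0 : s != 0 by rewrite sqr_cV_eq0.
  have WW : W *m W = s *: W.
    by rewrite /W mulmxA -(mulmxA w) (dotE w w) mul_mx_scalar -scalemxAl.
  rewrite HE mulmxBr mulmx1 mulmxBl mul1mx -scalemxAl -scalemxAr WW !scalerA.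
  have -> : 2 / s * (2 / s) * s = 2 / s + 2 / s by field.
  by rewrite scalerDl opprB addrK subrK.
pose N := H *m M *m H.
have MN : M = H *m N *m H.
  by rewrite /N !mulmxA HH mul1mx -mulmxA HH mulmx1.
have Ne : N *m e = a *: e.
  by rewrite /N -{1}Hv -!mulmxA (mulmxA H H v) HH mul1mx Mv -scalemxAr Hv.
have Nsym : N^T = N by rewrite /N !trmx_mul HT Msym mulmxA.
have [ulE dlE] : ulsubmx N = a%:M /\ dlsubmx N = 0.
  move: Ne; rewrite -{1}[N]submxK /e mul_block_col !mulmx1 !mulmx0 !addr0.
  by rewrite scale_col_mx scaler0 scalemx1 => /eq_col_mx[].
have urE : ursubmx N = 0 by rewrite -[ursubmx N]trmxK trmx_ursub Nsym dlE trmx0.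
have [U [d [UU dE]]] : exists (U : 'M[R]_m) (d : 'rV[R]_m),
    U^T *m U = 1%:M /\ drsubmx N = U^T *m diag_mx d *m U.
  by apply: IHm; rewrite trmx_drsub Nsym.
pose Q : 'M[R]_(1 + m) := block_mx 1%:M 0 0 U.
have QT : Q^T = block_mx 1%:M 0 0 U^T by rewrite tr_block_mx !trmx0 trmx1.
have NE : N = Q^T *m diag_mx (row_mx a%:M d) *m Q.
  rewrite -[N]submxK ulE dlE urE dE diag_mx_row QT /Q.
  rewrite !mulmx_block !(mulmx0, mul0mx, addr0, add0r, mulmx1, mul1mx) -!mulmxA.
  by congr block_mx; apply/matrixP => i j; rewrite !ord1 !mxE eqxx.
have QQ : Q^T *m Q = 1%:M.
  by rewrite QT mulmx_block !(mulmx0, mul0mx, addr0, add0r, mulmx1) UU -scalar_mx_block.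
exists (Q *m H), (row_mx a%:M d); split.
  by rewrite trmx_mul HT -mulmxA (mulmxA Q^T) QQ mul1mx HH.
by rewrite trmx_mul HT MN NE !mulmxA.
Qed.

(** The characteristic polynomial is the product of the 'X - d_i, so the
    multiplicity of a as its root counts the indices i with d_i = a. *)
Lemma mx_signature_spectral m (U : 'M[R]_m) (d : 'rV[R]_m) :
  U^T *m U = 1%:M ->
  mx_signature (U^T *m diag_mx d *m U) = \sum_i sgz (d 0 i).
Proof.
move=> UU; have UU' : U *m U^T = 1%:M by exact: mulmx1C.
pose s := [seq d 0 i | i <- index_enum 'I_m].
have charE : char_poly (U^T *m diag_mx d *m U) = \prod_(y <- s) ('X - y%:P).
  transitivity (char_poly (diag_mx d)).
    pose UP := map_mx (@polyC R) U.
    have UPU : UP^T *m UP = 1%:M by rewrite /UP map_trmx -map_mxM UU map_mx1.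
    rewrite /char_poly.
    have -> : char_poly_mx (U^T *m diag_mx d *m U) = UP^T *m char_poly_mx (diag_mx d) *m UP.
      rewrite /char_poly_mx mulmxBr mulmxBl scalar_mxC -(mulmxA _ _ UP) UPU mulmx1.
      by rewrite /UP map_trmx -!map_mxM.
    rewrite !det_mulmx mulrC mulrA -det_mulmx.
    by rewrite (mulmx1C UPU) det1 mul1r.
  rewrite char_poly_trig ?diag_mx_is_trig // big_map.
  by apply: eq_bigr => i _; rewrite mxE eqxx.
have muE a : mup a (char_poly (U^T *m diag_mx d *m U)) = (\sum_(i < m) (d ord0 i == a))%N.
  rewrite charE mu_prod_XsubC /s count_map -sum1_count big_mkcond.
  by apply: eq_bigr => i _ /=; case: (_ == _).
have cntE (P : set R) : \sum_(a \in P) (mup a (char_poly (U^T *m diag_mx d *m U)))%:Z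
    = \sum_(i < m) ((d 0 i \in P) : nat)%:Z.
  have <- : [set` mem P] = P by rewrite set_mem_set.
  rewrite -(@bigfs _ _ _ _ (undup s)) ?undup_uniq //; last first.
    move=> a _; rewrite mem_undup => /negP aNs; rewrite muE big1 // => i _.
    by case: eqP => // da; case: aNs; apply/mapP; exists i; rewrite ?mem_index_enum.
  under eq_bigr => a _ do rewrite muE -natz natr_sum /=.
  rewrite exchange_big /=; apply: eq_bigr => i _.
  have dis : d 0 i \in undup s.
    by rewrite mem_undup; apply/mapP; exists i; rewrite ?mem_index_enum.
  rewrite big_mkcond (bigD1_seq (d 0 i)) ?undup_uniq //= eqxx big1 ?addr0.
    by rewrite set_mem_set -[in_set P _]/(d 0 i \in P); case: (_ \in _).
  by move=> a; rewrite eq_sym => /negPf ->; case: ifP.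
rewrite /mx_signature !cntE -sumrB; apply: eq_bigr => i _.
have memE (P : pred R) x : (x \in [set y | P y]) = P x by apply/idP/idP; rewrite inE.
rewrite (memE (fun y => 0 < y)) (memE (fun y => y < 0)).
by case: sgzP => h; rewrite ?ltxx // ?h ?(lt_gtF h) ?subr0 ?sub0r.
Qed.
End Spectral.

(** * Sylvester's law of inertia *)

Section Inertia.
Context {R : realType}.

Definition pos_count m (d : 'rV[R]_m) : nat := #|finset (fun i => 0 < d 0 i)|.

Lemma quad_diagE m (d : 'rV[R]_m) (x : 'cV[R]_m) :
  (x^T *m diag_mx d *m x) 0 0 = \sum_i d 0 i * x i 0 ^+ 2.
Proof.
rewrite -mulmxA mxE; apply: eq_bigr => i _; rewrite mul_diag_mx !mxE.
by rewrite expr2 mulrCA.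
Qed.

Lemma wide_kernel p q (A : 'M[R]_(q, p)) : (q < p)%N ->
  exists2 x : 'cV[R]_p, x != 0 & A *m x = 0.
Proof.
move=> qp; have : kermx A^T != 0.
  rewrite kermx_eq0 /row_free; apply/negP => /eqP e.
  by have := rank_leq_col A^T; rewrite e leqNgt qp.
case/rowV0Pn => v /sub_kermxP vA v0; exists v^T.
  by rewrite -trmx0 (inj_eq trmx_inj).
by apply: trmx_inj; rewrite trmx_mul trmxK vA trmx0.
Qed.

(** If e had fewer positive terms than d, a nonzero vector of the coordinate
    subspace where d is positive would be sent by C to one without components
    along them. *)
Lemma positive_count_le p q (d : 'rV[R]_p) (e : 'rV[R]_q) (C : 'M[R]_(q, p)) :
  (forall y : 'cV[R]_p, y != 0 -> (forall i, y i 0 != 0 -> 0 < d 0 i) ->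
    0 < ((C *m y)^T *m diag_mx e *m (C *m y)) 0 0) ->
  (pos_count d <= pos_count e)%N.
Proof.
move=> pos; rewrite leqNgt /pos_count; apply/negP => lt.
set I := finset (fun i => 0 < d 0 i) in lt; set J := finset (fun i => 0 < e 0 i) in lt.
pose S := \matrix_(i < p, k < #|I|) ((i == enum_val k)%:R : R).
pose T := \matrix_(k < #|J|, i < q) ((i == enum_val k)%:R : R).
have [x x0 Ax] := wide_kernel (T *m C *m S) lt.
have SxE k : (S *m x) (enum_val k) 0 = x k 0.
  rewrite mxE (bigD1 k) //= big1 ?addr0 => [|l lk]; rewrite mxE ?eqxx ?mul1r //.
  by rewrite (inj_eq enum_val_inj) eq_sym (negPf lk) mul0r.
have := pos (S *m x); rewrite quad_diagE => H.
suff : \sum_i e 0 i * (C *m (S *m x)) i 0 ^+ 2 <= 0.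
  rewrite leNgt => /negP; apply; apply: H.
    apply: contra_neq x0 => Sx0; apply/colP => k.
    by rewrite -SxE Sx0 !mxE.
  move=> i; apply: contraR => di; rewrite mxE big1 // => k _; rewrite mxE.
  case: eqP => [ik|]; last by rewrite mul0r.
  by move: di; rewrite ik; have := enum_valP k; rewrite inE => ->.
apply: sumr_le0 => i _; have [ei|ei] := ltP 0 (e 0 i); last first.
  by apply: mulr_le0_ge0 => //; exact: sqr_ge0.
have iJ : i \in J by rewrite inE.
have : (T *m (C *m (S *m x))) (enum_rank_in iJ i) 0 = 0.
  by rewrite !mulmxA Ax mxE.
rewrite mxE (bigD1 i) //= big1 ?addr0 => [|l lk]; rewrite mxE enum_rankK_in //.
  by rewrite eqxx mul1r => ->; rewrite expr0n mulr0.
by rewrite (negPf lk) mul0r.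
Qed.

Lemma sum_sgzE m (d : 'rV[R]_m) : \sum_i sgz (d 0 i) =
  (pos_count d)%:Z - (pos_count (- d))%:Z.
Proof.
rewrite /pos_count -!sum1_card -!natz !natr_sum.
rewrite [in RHS]big_mkcond [X in _ - X]big_mkcond -sumrB.
apply: eq_bigr => i _; rewrite !inE mxE oppr_gt0.
by case: sgzP => h; rewrite ?h ?ltxx // ?h ?(lt_gtF h) ?subr0 ?sub0r.
Qed.

Lemma diag_congr_le p q (d : 'rV[R]_p) (e : 'rV[R]_q) (C : 'M[R]_(q, p)) :
  diag_mx d = C^T *m diag_mx e *m C ->
  (pos_count d <= pos_count e)%N.
Proof.
move=> dE; apply: (@positive_count_le _ _ _ _ C) => y y0 ypos.
have -> : (C *m y)^T *m diag_mx e *m (C *m y) = y^T *m diag_mx d *m y.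
  by rewrite dE trmx_mul !mulmxA.
rewrite quad_diagE.
have pos i : 0 <= d 0 i * y i 0 ^+ 2.
  have [->|yi] := eqVneq (y i 0) 0; first by rewrite expr0n mulr0.
  by apply: mulr_ge0; [exact/ltW/ypos | exact: sqr_ge0].
rewrite lt_def sumr_ge0 ?andbT // psumr_eq0 //.
apply: contra_neqN y0 => /allP h; apply/colP => i; rewrite [RHS]mxE.
have /eqP := h i (mem_index_enum _); apply: contraPeq => yi; apply/eqP.
by rewrite mulf_neq0 ?expf_neq0 // gt_eqF // ypos.
Qed.

Lemma diag_congr p q (d : 'rV[R]_p) (e : 'rV[R]_q) C D :
  diag_mx d = C^T *m diag_mx e *m C -> diag_mx e = D^T *m diag_mx d *m D ->
  \sum_i sgz (d 0 i) = \sum_i sgz (e 0 i).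
Proof.
move=> dE eE; rewrite !sum_sgzE.
have dNE : diag_mx (- d) = C^T *m diag_mx (- e) *m C.
  by rewrite [diag_mx (- d)]linearN [diag_mx (- e)]linearN /= dE mulmxN mulNmx.
have eNE : diag_mx (- e) = D^T *m diag_mx (- d) *m D.
  by rewrite [diag_mx (- d)]linearN [diag_mx (- e)]linearN /= eE mulmxN mulNmx.
congr (_%:Z - _%:Z); apply/eqP; rewrite eqn_leq.
  by rewrite (diag_congr_le dE) (diag_congr_le eE).
by rewrite (diag_congr_le dNE) (diag_congr_le eNE).
Qed.

Lemma sym_congr p q (M : 'M[R]_p) (C : 'M[R]_(p, q)) : M^T = M ->
  (C^T *m M *m C)^T = C^T *m M *m C.
Proof. by move=> Msym; rewrite !trmx_mul trmxK Msym mulmxA. Qed.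

(** Two diagonalisations of the same form have the same number of positive
    terms, by [positive_count_le] in both directions. M and N may have different
    sizes because the bases of a subspace come with index types whose sizes are
    equal by proof only. *)
Lemma mx_signature_congr p q (M : 'M[R]_p) (N : 'M[R]_q) C D : M^T = M ->
  N = C^T *m M *m C -> M = D^T *m N *m D -> mx_signature M = mx_signature N.
Proof.
move=> Msym NE ME; have Nsym : N^T = N by rewrite NE sym_congr.
have [U [d [UU dE]]] := spectral_theorem Msym.
have [V [e [VV eE]]] := spectral_theorem Nsym.
rewrite dE eE !mx_signature_spectral //.
have UU' := mulmx1C UU; have VV' := mulmx1C VV.
apply: (@diag_congr _ _ _ _ (V *m D *m U^T) (U *m C *m V^T)).
  have <- : U *m M *m U^T = diag_mx d by rewrite dE !mulmxA UU' mul1mx -mulmxA UU' mulmx1.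
  by rewrite ME eE !trmx_mul !trmxK !mulmxA.
have <- : V *m N *m V^T = diag_mx e by rewrite eE !mulmxA VV' mul1mx -mulmxA VV' mulmx1.
by rewrite NE dE !trmx_mul !trmxK !mulmxA.
Qed.

Lemma mx_signature_unit_congr p (M C : 'M[R]_p) : M^T = M -> C \in unitmx ->
  mx_signature (C^T *m M *m C) = mx_signature M.
Proof.
move=> Msym Cu; apply/esym.
apply: (@mx_signature_congr _ _ _ _ C (invmx C)) => //.
by rewrite !mulmxA -trmx_mul mulmxV // trmx1 mul1mx -mulmxA mulmxV // mulmx1.
Qed.

Lemma mx_signature_diag p (d : 'rV[R]_p) :
  mx_signature (diag_mx d) = \sum_i sgz (d 0 i).
Proof.
have := @mx_signature_spectral R p 1%:M d.
by rewrite trmx1 mulmx1 mul1mx mulmx1; apply.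
Qed.

Lemma mx_signature_congr_diag p (C : 'M[R]_p) (d : 'rV[R]_p) : C \in unitmx ->
  mx_signature (C^T *m diag_mx d *m C) = \sum_i sgz (d 0 i).
Proof. by move=> Cu; rewrite mx_signature_unit_congr ?tr_diag_mx ?mx_signature_diag. Qed.

Lemma mx_signature0 p : mx_signature (0 : 'M[R]_p) = 0.
Proof.
have -> : 0 = diag_mx (0 : 'rV[R]_p) by rewrite linear0.
by rewrite mx_signature_diag big1 // => i _; rewrite mxE sgz0.
Qed.

Lemma mx_signatureN p (M : 'M[R]_p) : M^T = M ->
  mx_signature (- M) = - mx_signature M.
Proof.
move=> Msym; have [U [d [UU dE]]] := spectral_theorem Msym.
rewrite dE mx_signature_spectral // -mulNmx -mulmxN -linearN /=.
rewrite mx_signature_spectral // -sumrN; apply: eq_bigr => i _.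
by rewrite mxE sgzN.
Qed.

Lemma mx_signature_block p q (M : 'M[R]_p) (N : 'M[R]_q) : M^T = M -> N^T = N ->
  mx_signature (block_mx M 0 0 N) = mx_signature M + mx_signature N.
Proof.
move=> Msym Nsym; have [U [d [UU ->]]] := spectral_theorem Msym.
have [V [e [VV ->]]] := spectral_theorem Nsym.
pose Q := block_mx U 0 0 V; have QT : Q^T = block_mx U^T 0 0 V^T.
  by rewrite tr_block_mx !trmx0.
have -> : block_mx (U^T *m diag_mx d *m U) 0 0 (V^T *m diag_mx e *m V)
    = Q^T *m diag_mx (row_mx d e) *m Q.
  rewrite QT diag_mx_row !mulmx_block.
  by rewrite !(mulmx0, mul0mx, addr0, add0r).
rewrite !mx_signature_spectral //; last first.
  by rewrite QT mulmx_block !(mulmx0, mul0mx, addr0, add0r) UU VV -scalar_mx_block.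
rewrite big_split_ord /=; congr (_ + _); apply: eq_bigr => i _.
  by rewrite row_mxEl.
by rewrite row_mxEr.
Qed.

(** This compares the signatures that two complements of the reference
    Lagrangian give to one Lagrangian subspace.
    Write c^T b as the pull-back by c of the symmetric matrix S = b c^-1. Then
    e^T b and c^T e are the pull-backs of S - r S^2 and 1 - r S, so the three
    forms are diagonal in one basis. On an eigenvalue s, with s <> 1/r because
    e is invertible, s - r s^2 has the sign of s unless s > 1/r, and these
    eigenvalues are the ones that 1 - r s counts negatively. *)
Lemma mx_signature_shift m (b c e : 'M[R]_m) (r : R) : 0 < r ->
  (c^T *m b)^T = c^T *m b -> e = c - r *: b -> c \in unitmx -> e \in unitmx ->
  mx_signature (c^T *m b) - mx_signature (e^T *m b)
    = m%:Z - mx_signature (c^T *m e).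
Proof.
move=> r0 csym eE cu eu; pose S := b *m invmx c.
have bE : b = S *m c by rewrite /S mulmxKV.
have Ssym : S^T = S.
  have : c^T *m S^T *m c = c^T *m S *m c.
    by move: csym; rewrite trmx_mul trmxK bE trmx_mul !mulmxA.
  move=> /(congr1 (mulmx^~ (invmx c))); rewrite !mulmxK //.
  by move=> /(congr1 (mulmx (invmx c^T))); rewrite !mulKmx ?unitmx_tr.
have [U [d [UU dE]]] := spectral_theorem Ssym.
have UU' := mulmx1C UU; have Uu : U \in unitmx by case: (mulmx1_unit UU).
pose P := U *m c; have Pu : P \in unitmx by rewrite unitmx_mul Uu.
have bP : b = U^T *m diag_mx d *m P by rewrite bE dE /P !mulmxA.
have cP : c = U^T *m P by rewrite /P mulmxA UU mul1mx.
clearbody P.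
pose f : 'rV[R]_m := \row_i (1 - r * d 0 i).
have fE : diag_mx f = 1%:M - r *: diag_mx d.
  apply/matrixP => i j; rewrite !mxE; case: eqP => _; rewrite ?mulr1n //.
  by rewrite !mulr0n mulr0 subr0.
have eP : e = U^T *m diag_mx f *m P.
  by rewrite eE fE mulmxBr mulmx1 mulmxBl -cP -scalemxAr -scalemxAl -bP.
pose g : 'rV[R]_m := \row_i (f 0 i * d 0 i).
have gE : diag_mx f *m diag_mx d = diag_mx g.
  by rewrite mulmx_diag.
have -> : c^T *m b = P^T *m diag_mx d *m P.
  by rewrite cP bP trmx_mul trmxK !mulmxA -(mulmxA _ U U^T) UU' mulmx1.
have -> : e^T *m b = P^T *m diag_mx g *m P.
  rewrite eP bP !trmx_mul trmxK tr_diag_mx -gE !mulmxA.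
  by rewrite -(mulmxA _ U U^T) UU' mulmx1.
have -> : c^T *m e = P^T *m diag_mx f *m P.
  by rewrite cP eP trmx_mul trmxK !mulmxA -(mulmxA _ U U^T) UU' mulmx1.
have f0 i : f 0 i != 0.
  have : diag_mx f \in unitmx.
    by move: eu; rewrite eP !unitmx_mul => /andP[/andP[]].
  by rewrite unitmxE det_diag unitfE => /prodf_neq0; apply.
rewrite !mx_signature_congr_diag // -sumrB.
have -> : m%:Z = \sum_(i < m) 1 by rewrite sumr_const card_ord natz.
rewrite -sumrB; apply: eq_bigr => i _; rewrite [g 0 i]mxE sgzM.
case: (sgzP (f 0 i)) => fi; rewrite ?mul1r ?subrr //.
  by move: (f0 i); rewrite fi eqxx.
have -> : sgz (d 0 i) = 1; last by [].
by apply/gtr0_sgz; move: fi; rewrite mxE => h; rewrite -(pmulr_rgt0 _ r0); lra.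
Qed.

End Inertia.

(** * Signatures of converging families of symmetric matrices *)

Section Perturbation.
Context {R : realType}.

(** Entrywise, so that the limits of products, determinants and inverses are
    those of the scalars they are made of. *)
Definition mx_cvg (T : Type) (F : set_system T) p q (A : T -> 'M[R]_(p, q))
    (B : 'M[R]_(p, q)) : Prop :=
  forall i j, (A x i j @[x --> F]) --> B i j.

Section Limits.
Context {T : Type} {F : set_system T} {FF : Filter F}.

Lemma mx_cvg_cst p q (B : 'M[R]_(p, q)) : mx_cvg F (fun=> B) B.
Proof. by move=> i j; apply: cvg_cst. Qed.

Lemma mx_cvg_mul p q r (A : T -> 'M[R]_(p, q)) (B : T -> 'M[R]_(q, r)) A0 B0 :
  mx_cvg F A A0 -> mx_cvg F B B0 -> mx_cvg F (fun x => A x *m B x) (A0 *m B0).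
Proof.
move=> hA hB i j; rewrite mxE.
under eq_fun do rewrite mxE.
apply: cvg_big => [|k _]; first exact: add_continuous.
exact: cvgM.
Qed.

Lemma mx_cvg_tr p q (A : T -> 'M[R]_(p, q)) A0 :
  mx_cvg F A A0 -> mx_cvg F (fun x => (A x)^T) A0^T.
Proof. by move=> hA i j; rewrite mxE; under eq_fun do rewrite mxE; exact: hA. Qed.

Lemma mx_cvgD p q (A B : T -> 'M[R]_(p, q)) A0 B0 :
  mx_cvg F A A0 -> mx_cvg F B B0 -> mx_cvg F (fun x => A x + B x) (A0 + B0).
Proof.
by move=> hA hB i j; rewrite mxE; under eq_fun do rewrite mxE; exact: cvgD.
Qed.

Lemma mx_cvgZ p q (h : T -> R) (A : T -> 'M[R]_(p, q)) (a : R) A0 :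
  h @ F --> a -> mx_cvg F A A0 -> mx_cvg F (fun x => h x *: A x) (a *: A0).
Proof.
by move=> hh hA i j; rewrite mxE; under eq_fun do rewrite mxE; exact: cvgM.
Qed.

Lemma mx_cvg_block p q r s (A : T -> 'M[R]_(p, q)) (B : T -> 'M[R]_(p, r))
    (C : T -> 'M[R]_(s, q)) (D : T -> 'M[R]_(s, r)) A0 B0 C0 D0 :
  mx_cvg F A A0 -> mx_cvg F B B0 -> mx_cvg F C C0 -> mx_cvg F D D0 ->
  mx_cvg F (fun x => block_mx (A x) (B x) (C x) (D x)) (block_mx A0 B0 C0 D0).
Proof.
move=> hA hB hC hD i j; case: (split_ordP i) => k ->; case: (split_ordP j) => l ->.
- by rewrite block_mxEul; under eq_fun do rewrite block_mxEul; exact: hA.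
- by rewrite block_mxEur; under eq_fun do rewrite block_mxEur; exact: hB.
- by rewrite block_mxEdl; under eq_fun do rewrite block_mxEdl; exact: hC.
- by rewrite block_mxEdr; under eq_fun do rewrite block_mxEdr; exact: hD.
Qed.

Lemma mx_cvg_eq p q (A B : T -> 'M[R]_(p, q)) A0 :
  (\forall x \near F, A x = B x) -> mx_cvg F A A0 -> mx_cvg F B A0.
Proof.
move=> AB hA i j; apply: cvg_trans (hA i j); apply: near_eq_cvg.
by apply: filterS AB => x ->.
Qed.

Lemma cvg_det m (A : T -> 'M[R]_m) A0 :
  mx_cvg F A A0 -> (\det (A x) @[x --> F]) --> \det A0.
Proof.
move=> hA; rewrite /determinant.
apply: cvg_big => [|s _]; first exact: add_continuous.
apply: cvgM; first exact: cvg_cst.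
apply: cvg_big => [|i _]; [exact: mul_continuous | exact: hA].
Qed.

Lemma near_unitmx m (A : T -> 'M[R]_m) A0 :
  mx_cvg F A A0 -> A0 \in unitmx -> \forall x \near F, A x \in unitmx.
Proof.
move=> /cvg_det hA; rewrite unitmxE unitfE => A0u.
have [e e0 he] : exists2 e : R, 0 < e & e <= `|\det A0|.
  by exists `|\det A0| => //; rewrite normr_gt0.
move/cvgrPdist_lt: hA => /(_ _ e0); apply: filterS => x hx.
rewrite unitmxE unitfE; apply: contraTneq hx => ->.
by rewrite subr0 -leNgt.
Qed.

Lemma mx_cvg_inv m (A : T -> 'M[R]_m) A0 :
  mx_cvg F A A0 -> A0 \in unitmx -> mx_cvg F (fun x => invmx (A x)) (invmx A0).
Proof.
move=> hA A0u; apply: (@mx_cvg_eq _ _ (fun x => (\det (A x))^-1 *: \adj (A x))).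
  by apply: filterS (near_unitmx hA A0u) => x Au; rewrite /invmx Au.
rewrite /invmx A0u; apply: mx_cvgZ.
  apply: cvgV; last exact: cvg_det.
  by move: A0u; rewrite unitmxE unitfE.
move=> i j; rewrite mxE; under eq_fun do rewrite mxE.
apply: cvgM; first exact: cvg_cst.
apply: cvg_det => k l; rewrite !mxE; under eq_fun do rewrite !mxE.
exact: hA.
Qed.

End Limits.

Lemma quad_bound m (E : 'M[R]_m) (x : 'cV[R]_m) (e : R) :
  (forall i j, `|E i j| <= e) ->
  `|(x^T *m E *m x) 0 0| <= e * m%:R * (x^T *m x) 0 0.
Proof.
move=> hE; rewrite -mulmxA mxE.
have -> : e * m%:R * (x^T *m x) 0 0 =
    \sum_(i < m) \sum_(j < m) e * ((x i 0 ^+ 2 + x j 0 ^+ 2) / 2).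
  under eq_bigr do rewrite -mulr_sumr -mulr_suml big_split /= sumr_const card_ord.
  rewrite -mulr_sumr -mulr_suml big_split /= sumr_const card_ord sumrMnl -sqr_cVE.
  by rewrite -mulr_natl; field.
apply: le_trans (ler_norm_sum _ _ _) _; apply: ler_sum => i _.
rewrite !mxE mulr_sumr; apply: le_trans (ler_norm_sum _ _ _) _.
apply: ler_sum => j _; rewrite mulrCA normrM ler_pM //.
have := sqr_ge0 (x i 0 + x j 0); have := sqr_ge0 (x i 0 - x j 0).
rewrite ler_norml => h1 h2; apply/andP; split; nra.
Qed.

Lemma finite_lower_bound m (f : 'I_m -> R) : (forall i, 0 < f i) ->
  exists2 d : R, 0 < d & forall i, d <= f i.
Proof.
move=> f0; exists (\big[Num.min/1]_i f i).
  by apply/lt_bigmin; rewrite ?ltr01.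
by move=> i; exact: bigmin_le.
Qed.

(** On the span of the eigenvectors with positive eigenvalue the form stays
    positive under a small perturbation, and likewise for the negative ones.
    As M0 is invertible these eigenvectors span the whole space, so neither
    count can grow. *)
Lemma mx_signature_near m (M0 : 'M[R]_m) : M0^T = M0 -> M0 \in unitmx ->
  exists2 e : R, 0 < e & forall M : 'M[R]_m, M^T = M ->
    (forall i j, `|M i j - M0 i j| <= e) ->
    mx_signature M = mx_signature M0 /\ M \in unitmx.
Proof.
move=> M0sym M0u; have [U [d [UU dE]]] := spectral_theorem M0sym.
have UU' := mulmx1C UU.
have d0 i : d 0 i != 0.
  have : diag_mx d \in unitmx.
    by move: M0u; rewrite dE !unitmx_mul => /andP[/andP[]].
  by rewrite unitmxE det_diag unitfE => /prodf_neq0; apply.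
have [r r0 rd] : exists2 r : R, 0 < r & forall i, r <= `|d 0 i|.
  by apply: finite_lower_bound => i; rewrite normr_gt0.
exists (r / (m%:R + 1)); first by rewrite divr_gt0 // ltr_wpDl.
move=> M Msym near0; have [V [e [VV eE]]] := spectral_theorem Msym.
have VV' := mulmx1C VV.
have small (x : 'cV[R]_m) : x != 0 ->
    `|(x^T *m (M - M0) *m x) 0 0| < r * (x^T *m x) 0 0.
  move=> x0; have h : forall i j, `|(M - M0) i j| <= r / (m%:R + 1).
    by move=> i j; rewrite !mxE; exact: near0.
  apply: le_lt_trans (quad_bound x h) _.
  rewrite ltr_pM2r ?sqr_cV_gt0 // -mulrA gtr_pMr //.
  by rewrite mulrC ltr_pdivrMr ?mul1r ?ltrDl ?ltr_wpDl ?ler0n ?ltr01.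
(* s is a sign: 1 treats the positive eigenvalues, -1 the negative ones. *)
have key (s : R) : `|s| = 1 ->
    (pos_count (s *: d) <= pos_count (s *: e))%N.
  move=> s1; apply: (@positive_count_le _ _ _ _ _ (V *m U^T)) => y y0 ypos.
  have x0 : U^T *m y != 0.
    apply: contra_neq y0 => /(congr1 (mulmx U)).
    by rewrite mulmxA UU' mul1mx mulmx0.
  have -> : (V *m U^T *m y)^T *m diag_mx (s *: e) *m (V *m U^T *m y)
     = s *: (y^T *m diag_mx d *m y + (U^T *m y)^T *m (M - M0) *m (U^T *m y)).
    rewrite [diag_mx _]linearZ /= -scalemxAr -scalemxAl; congr (_ *: _).
    have -> : diag_mx e = V *m M *m V^T by rewrite eE !mulmxA VV' mul1mx -mulmxA VV' mulmx1.
    have -> : diag_mx d = U *m M0 *m U^T by rewrite dE !mulmxA UU' mul1mx -mulmxA UU' mulmx1.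
    rewrite mulmxBr mulmxBl !trmx_mul !trmxK !mulmxA addrC subrK.
    by rewrite -(mulmxA _ V^T V) VV mulmx1 -(mulmxA _ V^T V) VV mulmx1.
  have := small _ x0; set E := (_ *m (M - M0) *m _) => hE.
  have xx : (U^T *m y)^T *m (U^T *m y) = y^T *m y.
    by rewrite trmx_mul trmxK mulmxA -(mulmxA _ U) UU' mulmx1.
  rewrite xx in hE.
  have : r * (y^T *m y) 0 0 <= s * (y^T *m diag_mx d *m y) 0 0.
    rewrite quad_diagE sqr_cVE !mulr_sumr; apply: ler_sum => i _.
    have [->|yi] := eqVneq (y i 0) 0; first by rewrite expr0n !mulr0.
    rewrite mulrA ler_wpM2r ?sqr_ge0 //; have := ypos i yi; rewrite mxE => si.
    by apply: le_trans (rd i) _; rewrite -[`|_|]mul1r -s1 -normrM gtr0_norm.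
  have : `|s * E 0 0| < r * (y^T *m y) 0 0 by rewrite normrM s1 mul1r.
  rewrite ltr_norml => /andP[h1 h2] h3.
  rewrite mxE [X in _ * X]mxE mulrDr; lra.
have c1 := key 1 (normr1 _); have c2 := key (-1) (normrN1 _).
rewrite !scaleN1r in c2; rewrite !scale1r in c1.
have cntE (f : 'rV[R]_m) : (pos_count f + pos_count (- f) + #|[pred i | (f 0 i == 0)%R]| = m)%N.
  rewrite /pos_count -!sum1_card !(big_mkcond (fun i => i \in _)) -!big_split /=.
  rewrite -[RHS]card_ord -sum1_card; apply: eq_bigr => i _; rewrite !inE mxE oppr_gt0.
  by case: (ltgtP (f 0 i) 0).
have nz0 : #|[pred i | (d 0 i == 0)%R]| = 0%N.
  by apply: eq_card0 => i; rewrite !inE (negPf (d0 i)).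
have := cntE d; have := cntE e; rewrite nz0 addn0 => ce cd.
have [e1 e2 e3] : [/\ pos_count e = pos_count d, pos_count (- e) = pos_count (- d)
    & #|[pred i | (e 0 i == 0)%R]| = 0%N].
  move: c1 c2 ce cd; clear.
  move: (pos_count d) (pos_count e) (pos_count (- d)) (pos_count (- e)) #|_| => *.
  by split; lia.
split.
  by rewrite dE eE !mx_signature_spectral // !sum_sgzE e1 e2.
rewrite eE !unitmx_mul unitmx_tr.
have -> : V \in unitmx by case: (mulmx1_unit VV').
rewrite andbT /= unitmxE det_diag unitfE; apply/prodf_neq0 => i _.
by move/card0_eq: e3 => /(_ i); rewrite !inE => ->.
Qed.

Lemma mx_signature_cvg T (F : set_system T) (FF : Filter F) m
    (M : T -> 'M[R]_m) (M0 : 'M[R]_m) :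
  M0^T = M0 -> M0 \in unitmx -> (\forall x \near F, (M x)^T = M x) ->
  mx_cvg F M M0 ->
  \forall x \near F, mx_signature (M x) = mx_signature M0 /\ M x \in unitmx.
Proof.
move=> M0sym M0u Msym MM0; have [e e0 he] := mx_signature_near M0sym M0u.
have : \forall x \near F, forall ij : 'I_m * 'I_m, `|M x ij.1 ij.2 - M0 ij.1 ij.2| <= e.
  apply: filter_forall => -[i j] /=.
  have /cvgrPdist_le /(_ _ e0) := MM0 i j.
  by apply: filterS => x; rewrite distrC.
apply: filterS2 Msym => x Msx h; apply: he => // i j; exact: (h (i, j)).
Qed.

(** In a basis made of a complement of the kernel followed by the kernel, scale
    the kernel vectors by 1/sqrt h. The off-diagonal blocks of S, which are
    O(h), become O(sqrt h), the block on the kernel converges to the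
    restriction of S', and the form tends to the nondegenerate orthogonal sum
    of S0 on the complement and S' on the kernel. *)
Lemma mx_signature_perturb T (F : set_system T) (FF : Filter F) m k
    (h : T -> R) (S : T -> 'M[R]_m) (S0 S' : 'M[R]_m) (K : 'M[R]_(m, k)) :
  (\forall x \near F, 0 < h x) -> h @ F --> 0 ->
  (\forall x \near F, (S x)^T = S x) -> S0^T = S0 ->
  mx_cvg F (fun x => (h x)^-1 *: (S x - S0)) S' ->
  row_free K^T -> S0 *m K = 0 ->
  (forall v : 'cV[R]_m, S0 *m v = 0 -> exists y : 'cV[R]_k, v = K *m y) ->
  (K^T *m S' *m K)^T = K^T *m S' *m K -> K^T *m S' *m K \in unitmx ->
  \forall x \near F,
    mx_signature (S x) = mx_signature S0 + mx_signature (K^T *m S' *m K)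
    /\ S x \in unitmx.
Proof.
move=> h0 hF Ssym S0sym SS' Kfree S0K Kker Gsym Gu.
set G := K^T *m S' *m K in Gsym Gu *.
(* r + k = m holds but is not a conversion: the change of basis C has the
   two-sided inverse D without being square in its type. *)
pose B1 := row_base (K^T^C)%MS; pose r := \rank (K^T^C)%MS.
pose B : 'M[R]_(r + k, m) := col_mx B1 K^T.
have rkm : (r + k)%N = m.
  have rK : \rank K^T = k by exact/eqP.
  by rewrite /r mxrank_compl rK subnK // -{1}rK rank_leq_col.
have Bfull : row_full B.
  rewrite -col_leq_rank -addsmxE.
  have -> : \rank (B1 + K^T)%MS = \rank (K^T + K^T^C)%MS.
    by rewrite addsmxC (adds_eqmx (eqmx_refl _) (eq_row_base _)).
  by rewrite col_leq_rank addsmx_compl_full.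
have Bfree : row_free B by move: Bfull; rewrite /row_full /row_free => /eqP ->; rewrite rkm.
pose C := B^T; pose D := (pinvmx B)^T.
have CD : C *m D = 1%:M by rewrite /C /D -trmx_mul mulVpmx // trmx1.
have DC : D *m C = 1%:M by rewrite /C /D -trmx_mul mulmxVp // trmx1.
pose U := B1^T; have CE : C = row_mx U K by rewrite /C /B tr_col_mx trmxK.
pose A0 := U^T *m S0 *m U.
have A0sym : A0^T = A0 by exact: sym_congr.
have K0 : K^T *m S0 = 0 by rewrite -S0sym -trmx_mul S0K trmx0.
have CSC (M : 'M[R]_m) : C^T *m M *m C =
    block_mx (U^T *m M *m U) (U^T *m M *m K) (K^T *m M *m U) (K^T *m M *m K).
  by rewrite CE tr_row_mx mul_col_mx mul_col_row.
have A0u : A0 \in unitmx.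
  apply: unitmx_inj => y A0y.
  have SU : S0 *m (U *m y) = 0.
    have : C^T *m (S0 *m (U *m y)) = 0.
      rewrite CE tr_row_mx mul_col_mx !mulmxA A0y K0 !mul0mx.
      by rewrite col_mx0.
    by move=> /(congr1 (mulmx D^T)); rewrite (mulmxA D^T C^T) -trmx_mul CD trmx1 mul1mx mulmx0.
  have [z Uz] := Kker _ SU.
  have : C *m col_mx y (- z) = 0 by rewrite CE mul_row_col mulmxN Uz subrr.
  move=> /(congr1 (mulmx D)); rewrite mulmxA DC mul1mx mulmx0 => /eqP.
  by rewrite col_mx_eq0 => /andP[/eqP].
have sgS0 : mx_signature S0 = mx_signature A0.
  rewrite (@mx_signature_congr _ _ _ S0 (block_mx A0 0 0 (0 : 'M[R]_k)) C D) //.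
  - by rewrite mx_signature_block ?trmx0 // mx_signature0 addr0.
  - by rewrite CSC -!(mulmxA _ S0 K) S0K K0 !mulmx0 mul0mx.
  - have -> : block_mx A0 0 0 (0 : 'M[R]_k) = C^T *m S0 *m C.
      by rewrite CSC -!(mulmxA _ S0 K) S0K K0 !mulmx0 mul0mx.
    by rewrite !mulmxA -trmx_mul -(mulmxA _ C) CD trmx1 mul1mx mulmx1.
pose s x := (Num.sqrt (h x))^-1.
pose E x : 'M[R]_(r + k) := block_mx 1%:M 0 0 (s x)%:M.
pose E' x : 'M[R]_(r + k) := block_mx 1%:M 0 0 (Num.sqrt (h x))%:M.
pose N x := (C *m E x)^T *m S x *m (C *m E x).
have EE x : 0 < h x -> E x *m E' x = 1%:M.
  move=> hx; rewrite /E /E' mulmx_block !(mulmx0, mul0mx, addr0, add0r, mulmx1).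
  have q0 : Num.sqrt (h x) != 0 by rewrite gt_eqF // sqrtr_gt0.
  by rewrite -scalar_mxM /s mulVf // -scalar_mx_block.
have NE x : N x = block_mx (U^T *m S x *m U) (s x *: (U^T *m S x *m K))
   (s x *: (K^T *m S x *m U)) (s x ^+ 2 *: (K^T *m S x *m K)).
  rewrite /N trmx_mul -!mulmxA (mulmxA (S x)) (mulmxA C^T) (mulmxA C^T) CSC.
  rewrite /E tr_block_mx !trmx0 trmx1 tr_scalar_mx !mulmx_block.
  rewrite !(mulmx0, mul0mx, addr0, add0r, mulmx1, mul1mx).
  by rewrite !mul_mx_scalar !mul_scalar_mx scalerA expr2 -!mulmxA.
have Slim : mx_cvg F S S0.
  apply: (@mx_cvg_eq _ _ _ _ _ (fun x => h x *: ((h x)^-1 *: (S x - S0)) + S0)).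
    by apply: filterS h0 => x hx; rewrite scalerA divff ?gt_eqF // scale1r subrK.
  rewrite -[X in mx_cvg _ _ X]add0r; apply: mx_cvgD; last exact: mx_cvg_cst.
  by rewrite -(scale0r S'); exact: mx_cvgZ.
have hs : (Num.sqrt (h x) @[x --> F]) --> (0 : R).
  by rewrite -(sqrtr0 R); apply: continuous_cvg => //; exact: sqrt_continuous.
have hUK : mx_cvg F (fun x => s x *: (U^T *m S x *m K)) 0.
  apply: (@mx_cvg_eq _ _ _ _ _
    (fun x => Num.sqrt (h x) *: (U^T *m ((h x)^-1 *: (S x - S0)) *m K))).
    apply: filterS h0 => x hx.
    rewrite -scalemxAr -scalemxAl scalerA mulmxBr mulmxBl -(mulmxA _ S0) S0K mulmx0 subr0.
    congr (_ *: _); have sE : s x = (Num.sqrt (h x))^-1 by [].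
    have hE : h x = Num.sqrt (h x) * Num.sqrt (h x) by rewrite -expr2 sqr_sqrtr ?ltW.
    have : Num.sqrt (h x) != 0 by rewrite gt_eqF // sqrtr_gt0.
    rewrite sE [in (h x)^-1]hE; move: (Num.sqrt (h x)) => q q0.
    by rewrite invfM mulrA divff // mul1r.
  rewrite -(scale0r (U^T *m S' *m K)); apply: mx_cvgZ => //.
  by apply: mx_cvg_mul; [apply: mx_cvg_mul => //|]; exact: mx_cvg_cst.
have Nlim : mx_cvg F N (block_mx A0 0 0 G).
  apply: (@mx_cvg_eq _ _ _ _ _ (fun x => block_mx (U^T *m S x *m U) (s x *: (U^T *m S x *m K))
   (s x *: (U^T *m S x *m K))^T (K^T *m ((h x)^-1 *: (S x - S0)) *m K))).
    apply: filterS2 h0 Ssym => x hx Sx; rewrite NE; congr block_mx.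
      by rewrite [LHS]linearZ /= !trmx_mul trmxK Sx mulmxA.
    rewrite -scalemxAr -scalemxAl mulmxBr mulmxBl -(mulmxA _ S0) S0K mulmx0 subr0.
    by rewrite /s exprVn sqr_sqrtr ?ltW.
  apply: mx_cvg_block => //.
  - by apply: mx_cvg_mul; [apply: mx_cvg_mul => //|]; exact: mx_cvg_cst.
  - by rewrite -trmx0; exact: mx_cvg_tr.
  - by apply: mx_cvg_mul; [apply: mx_cvg_mul => //|]; exact: mx_cvg_cst.
have N0sym : (block_mx A0 0 0 G)^T = block_mx A0 0 0 G.
  by rewrite tr_block_mx !trmx0 A0sym Gsym.
have N0u : block_mx A0 0 0 G \in unitmx.
  by rewrite unitmxE det_ublock unitrM -!unitmxE A0u Gu.
have Nsym : \forall x \near F, (N x)^T = N x.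
  by apply: filterS Ssym => x Sx; exact: sym_congr.
have := mx_signature_cvg FF N0sym N0u Nsym Nlim.
apply: filterS3 h0 Ssym => x hx Sx [sgN Nu].
have CE1 : C *m E x *m (E' x *m D) = 1%:M.
  by rewrite mulmxA -(mulmxA C) EE // mulmx1 CD.
have SN : S x = (E' x *m D)^T *m N x *m (E' x *m D).
  rewrite /N; have -> : (E' x *m D)^T *m ((C *m E x)^T *m S x *m (C *m E x)) *m (E' x *m D)
      = ((C *m E x) *m (E' x *m D))^T *m S x *m (C *m E x *m (E' x *m D)).
    by rewrite [in RHS]trmx_mul !mulmxA.
  by rewrite CE1 trmx1 mul1mx mulmx1.
split.
  rewrite (@mx_signature_congr _ _ _ (S x) (N x) (C *m E x) (E' x *m D)) //.
  by rewrite sgN mx_signature_block // sgS0.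
apply: unitmx_inj => v Sv.
have : N x *m (E' x *m D *m v) = 0.
  by rewrite /N -mulmxA (mulmxA (C *m E x) _ v) CE1 mul1mx -mulmxA Sv mulmx0.
move=> /(congr1 (mulmx (invmx (N x)))); rewrite mulKmx // mulmx0.
by move=> /(congr1 (mulmx (C *m E x))); rewrite mulmxA CE1 mul1mx mulmx0.
Qed.

End Perturbation.

(** * Index functions *)

Section IndexFunctions.
Context {R : realType}.

Lemma near_withinP (a b t : R) (P : R -> Prop) :
  (\forall x \near within `[a, b]%classic (nbhs t), P x) <->
  exists2 e : R, 0 < e & forall x, x \in `[a, b] -> `|t - x| < e -> P x.
Proof.
split=> [/nbhs_ballP[e /= e0 h]|[e e0 h]].
  by exists e => // x xab xt; apply: h.
apply/nbhs_ballP; exists e => //= x xt xab; exact: h.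
Qed.

(** The segment is connected, and both P and its negation are open on it. *)
Lemma locally_constant_segment (a b : R) (P : R -> Prop) :
  (forall t, t \in `[a, b] ->
     \forall x \near within `[a, b]%classic (nbhs t), P x <-> P t) ->
  P a -> forall t, t \in `[a, b] -> P t.
Proof.
move=> loc Pa t tab.
have ab : a <= b by move: tab; rewrite in_itv /= => /andP[]; exact: le_trans.
have aab : a \in `[a, b] by rewrite in_itv /= lexx ab.
pose B := [set x | x \in `[a, b] /\ P x].
suff BE : B = [set` `[a, b]] by have [] : B t by rewrite BE.
pose O (Q : R -> Prop) :=
  \bigcup_(V in [set V | open V /\ forall x, x \in `[a, b] -> V x -> Q x]) V.
have Oopen Q : open (O Q) by apply: bigcup_open => V [].
have inO (Q : R -> Prop) x : (\forall y \near within `[a, b]%classic (nbhs x), Q y) -> O Q x.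
  move=> /near_withinP[e e0 h]; exists (ball x e); last exact: ballxx.
  by split; [exact: ball_open | move=> y yab xy; exact: h].
have OP x : x \in `[a, b] -> O P x <-> P x.
  move=> xab; split=> [[V [_ h] Vx]|Px]; first exact: h.
  by apply: inO; apply: filterS (loc x xab) => y ->.
have ON x : x \in `[a, b] -> O (fun y => ~ P y) x <-> ~ P x.
  move=> xab; split=> [[V [_ h] Vx]|Px]; first exact: h.
  by apply: inO; apply: filterS (loc x xab) => y ->.
apply: (@segment_connected R a b).
- by exists a.
- exists (O P) => //; apply/seteqP; split=> x /=.
    by move=> [xab Px]; split => //; apply/OP.
  by move=> [xab /OP]; split => //; auto.
- exists (~` O (fun y => ~ P y)); first exact: open_closedC.
  apply/seteqP; split=> x /=.
    by move=> [xab Px]; split => // /ON; apply.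
  by move=> [xab h]; split => //; apply: contrapT => /ON; auto.
Qed.

Lemma between_near (t e u v x : R) : `|t - u| < e -> `|t - v| < e ->
  (u <= x) || (v <= x) -> (x <= u) || (x <= v) -> `|t - x| < e.
Proof.
rewrite !ltr_norml => /andP[? ?] /andP[? ?] /orP h1 /orP h2.
by apply/andP; split; case: h1; case: h2; lra.
Qed.

Section ChartSystem.
Context {X : topologicalType}.

(** What the chart signatures sigma j of a continuous family of Lagrangian
    subspaces satisfy on the sets tau j where they are meaningful. *)
Definition chart_system (D : set X) (tau : nat -> X -> Prop)
    (sigma : nat -> X -> int) : Prop :=
  [/\ forall x, D x -> exists j, tau j x,
      forall x j, D x -> tau j x -> \forall y \near within D (nbhs x), tau j y &
      forall x j k, D x -> tau j x -> tau k x ->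
        \forall y \near within D (nbhs x),
          sigma j y - sigma k y = sigma j x - sigma k x].

(** For a path of Lagrangian subspaces and the signatures sigma j of its charts,
    this is the function that counts twice the Robbin-Salamon index of the part
    of the path before x, up to a constant. *)
Definition index_function (D : set X) (tau : nat -> X -> Prop)
    (sigma : nat -> X -> int) (f : X -> int) : Prop :=
  forall x j, D x -> tau j x ->
    \forall y \near within D (nbhs x), f y - sigma j y = f x - sigma j x.

Lemma index_functionI D tau sigma f : chart_system D tau sigma ->
  (forall x, D x -> exists2 j, tau j x &
     \forall y \near within D (nbhs x), f y - sigma j y = f x - sigma j x) ->
  index_function D tau sigma f.
Proof.
move=> [_ _ cmp] h x k Dx tk; have [j tj] := h x Dx.
apply: filterS2 (cmp _ _ _ Dx tj tk) => y; clear; lia.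
Qed.

End ChartSystem.

Section OnSegment.
Variables (tau : nat -> R -> Prop) (sigma : nat -> R -> int).

Lemma index_function_sub (a b c d : R) f : (a <= c) -> (d <= b) ->
  index_function `[a, b]%classic tau sigma f ->
  index_function `[c, d]%classic tau sigma f.
Proof.
move=> ac db h x j; rewrite /= in_itv /= => /andP[cx xd] tj.
have xab : x \in `[a, b] by rewrite in_itv /= (le_trans ac) // (le_trans xd).
have /near_withinP[e e0 he] := h x j xab tj; apply/near_withinP; exists e => // y.
rewrite in_itv /= => /andP[cy yd]; apply: he.
by rewrite in_itv /= (le_trans ac) // (le_trans yd).
Qed.

Lemma index_function_chart (a b c d : R) f j :
  c \in `[a, b] -> d \in `[a, b] ->
  index_function `[a, b]%classic tau sigma f ->
  (forall x, x \in `[a, b] -> Num.min c d <= x -> x <= Num.max c d -> tau j x) ->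
  f d - sigma j d = f c - sigma j c.
Proof.
wlog cd : c d / c <= d.
  move=> H cab dab h ht; have [|/ltW] := leP c d => cd; first exact: (H c d).
  by apply/esym; apply: (H d c) => // x; rewrite minC maxC; exact: ht.
rewrite !in_itv /= => /andP[ac cb] /andP[ad db] h.
rewrite (min_idPl cd) (max_idPr cd) => ht.
apply: (@locally_constant_segment c d (fun t => f t - sigma j t = f c - sigma j c)) => //.
  move=> t; rewrite in_itv /= => /andP[ct td].
  have tab : t \in `[a, b] by rewrite in_itv /= (le_trans ac) // (le_trans td).
  have := index_function_sub ac db h; move=> /(_ t j).
  rewrite /= in_itv /= ct td => /(_ isT (ht t tab ct td)).
  by apply: filterS => x ->.
by rewrite in_itv /= lexx cd.
Qed.

Lemma index_function_unique (a b : R) f g :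
  chart_system `[a, b]%classic tau sigma ->
  index_function `[a, b]%classic tau sigma f ->
  index_function `[a, b]%classic tau sigma g ->
  a <= b -> f b - f a = g b - g a.
Proof.
move=> [ex _ _] hf hg ab.
suff : f b - g b = f a - g a by lia.
apply: (@locally_constant_segment a b (fun t => f t - g t = f a - g a)) => //.
  move=> t tab; have [j tj] := ex t tab.
  by apply: filterS2 (hf t j tab tj) (hg t j tab tj) => x; clear; lia.
by rewrite in_itv /= lexx ab.
Qed.

(** The local invariants are continued from chart to chart: a function found on
    [a, u] is extended to a slightly longer segment by the invariant of one
    chart around u. *)
Lemma index_function_exists (a b : R) (c : int) : a <= b ->
  chart_system `[a, b]%classic tau sigma ->
  exists2 f, f a = c & index_function `[a, b]%classic tau sigma f.
Proof.
move=> ab [ex op cmp].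
pose P t := exists2 f, f a = c & index_function `[a, t]%classic tau sigma f.
apply: (@locally_constant_segment a b P); last 2 first.
- exists (fun=> c) => // x j; rewrite /= in_itv /= => /andP[ax xa] tj.
  apply/near_withinP; exists 1 => // y; rewrite in_itv /= => /andP[ay ya] _.
  by have -> : y = x by lra.
- by rewrite in_itv /= lexx ab.
move=> t tab; have [j tj] := ex t tab.
have /near_withinP[e e0 he] := op t j tab tj.
suff ext u v : u \in `[a, b] -> v \in `[a, b] -> `|t - u| < e -> `|t - v| < e ->
    u <= v -> P u <-> P v.
  apply/near_withinP; exists e => // u uab tu.
  have tt : `|t - t| < e by rewrite subrr normr0.
  have [ut|/ltW tu'] := leP u t; first exact: ext.
  by apply: iff_sym; exact: ext.
rewrite !in_itv /= => /andP[au ub] /andP[av vb] tu tv uv; split; last first.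
  by move=> [f fa h]; exists f => //; apply: index_function_sub h.
move=> [f fa h]; pose g x := if x <= u then f x else f u + sigma j x - sigma j u.
exists g; first by rewrite /g au.
have inU x : u <= x -> x <= v -> tau j x.
  move=> ux xv; apply: he; first by rewrite in_itv /= (le_trans au) // (le_trans xv).
  by apply: (between_near tu tv); rewrite ?ux ?xv ?orbT.
move=> x k; rewrite /= in_itv /= => /andP[ax xv] tk.
have xab : x \in `[a, b] by rewrite in_itv /= ax (le_trans xv).
have [xu|ux|xu] := ltgtP x u.
- have xau : x \in `[a, u] by rewrite in_itv /= ax ltW.
  have /near_withinP[d d0 hd] := h x k xau tk.
  apply/near_withinP; exists (Num.min d (u - x)); first by rewrite lt_min d0 subr_gt0.
  move=> y; rewrite in_itv /= lt_min => /andP[ay yv] /andP[xyd xyu].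
  have yu : y <= u by move: xyu; rewrite ltr_norml => /andP[? ?]; lra.
  by rewrite /g yu (ltW xu); apply: hd; rewrite // in_itv /= ay yu.
- have tjx := inU x (ltW ux) xv.
  have /near_withinP[d d0 hd] := cmp x j k xab tjx tk.
  apply/near_withinP; exists (Num.min d (x - u)); first by rewrite lt_min d0 subr_gt0.
  move=> y; rewrite in_itv /= lt_min => /andP[ay yv] /andP[xyd xyu].
  have uy : u < y by move: xyu; rewrite ltr_norml => /andP[? ?]; lra.
  have yab : y \in `[a, b] by rewrite in_itv /= ay (le_trans yv).
  by have := hd y yab xyd; rewrite /g !leNgt uy ux /=; clear; lia.
- have xau : x \in `[a, u] by rewrite in_itv /= ax xu lexx.
  have tjx : tau j x by apply: inU => //; rewrite xu.
  have /near_withinP[d d0 hd] := h x k xau tk.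
  have /near_withinP[d' d'0 hd'] := cmp x j k xab tjx tk.
  apply/near_withinP; exists (Num.min d d'); first by rewrite lt_min d0 d'0.
  move=> y; rewrite in_itv /= lt_min => /andP[ay yv] /andP[xyd xyu].
  have yab : y \in `[a, b] by rewrite in_itv /= ay (le_trans yv).
  have -> : g x = f x by rewrite /g xu lexx.
  rewrite /g; have [yu|uy] := leP y u; first by apply: hd; rewrite // in_itv /= ay yu.
  by have := hd' y yab xyu; rewrite -xu; clear; lia.
Qed.

End OnSegment.

Lemma near_box (a b s t : R) (Q : R * R -> Prop) :
  (\forall y \near within ([set` `[0, 1]] `*` [set` `[a, b]]) (nbhs (s, t)), Q y) ->
  exists2 e : R, 0 < e & forall s' t', s' \in `[0, 1] -> t' \in `[a, b] ->
      `|s - s'| < e -> `|t - t'| < e -> Q (s', t').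
Proof.
move=> /nbhs_ballP[e /= e0 h]; exists e => // s' t' s'01 t'ab ss tt.
by apply: h => //; split.
Qed.

Lemma chart_system_row (a b s : R) (tau : nat -> R * R -> Prop)
    (sigma : nat -> R * R -> int) :
  chart_system ([set` `[0, 1]] `*` [set` `[a, b]] : set (R * R)) tau sigma ->
  s \in `[0, 1] ->
  chart_system `[a, b]%classic (fun j t => tau j (s, t)) (fun j t => sigma j (s, t)).
Proof.
move=> [ex op cmp] s01; split=> [t tab|t j tab tj|t j k tab tj tk].
- by apply: ex; split.
- have [|e e0 he] := near_box (op (s, t) j _ tj); first by split.
  apply/near_withinP; exists e => // x xab tx; apply: he => //.
  by rewrite subrr normr0.
- have [|e e0 he] := near_box (cmp (s, t) j k _ tj tk); first by split.
  apply/near_withinP; exists e => // x xab tx; apply: he => //.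
  by rewrite subrr normr0.
Qed.

(** Normalise the index function F s of each row s by F s a = 0. For s near a
    given row, F s t and the chart invariants at (s, t) vary in the same way
    with s: this is clear at t = a and propagates along the row, chart by chart,
    up to t = b. There the chart invariants do not depend on s, so F s b is
    locally constant in s. *)
Lemma index_homotopy (a b : R) (tau : nat -> R * R -> Prop)
    (sigma : nat -> R * R -> int) (f0 f1 : R -> int) : a <= b ->
  chart_system ([set` `[0, 1]] `*` [set` `[a, b]] : set (R * R)) tau sigma ->
  (forall j s, s \in `[0, 1] -> sigma j (s, a) = sigma j (0, a)) ->
  (forall j s, s \in `[0, 1] -> sigma j (s, b) = sigma j (0, b)) ->
  index_function `[a, b]%classic (fun j t => tau j (0, t)) (fun j t => sigma j (0, t)) f0 ->
  index_function `[a, b]%classic (fun j t => tau j (1, t)) (fun j t => sigma j (1, t)) f1 ->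
  f1 b - f1 a = f0 b - f0 a.
Proof.
move=> ab cs sa sb h0 h1; have [ex op cmp] := cs.
have row s (s01 : s \in `[0, 1]) := chart_system_row cs s01.
have /choice[F /all_and2[Fa Find]] : forall s : R, exists f : R -> int, f a = 0 /\
    (s \in `[0, 1] -> index_function `[a, b]%classic (fun j t => tau j (s, t))
       (fun j t => sigma j (s, t)) f).
  move=> s; have [s01|ns] := boolP (s \in `[0, 1]); last by exists (fun=> 0).
  by have [f fa hf] := index_function_exists 0 ab (row s s01); exists f.
have aab : a \in `[a, b] by rewrite in_itv /= lexx ab.
have bab : b \in `[a, b] by rewrite in_itv /= lexx ab.
have i01 : (1 : R) \in `[0, 1] by rewrite in_itv /= ler01 lexx.
have z01 : (0 : R) \in `[0, 1] by rewrite in_itv /= ler01 lexx.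
suff Fb : F 1 b = F 0 b.
  have := index_function_unique (row 0 z01) (Find 0 z01) h0 ab.
  have := index_function_unique (row 1 i01) (Find 1 i01) h1 ab.
  by rewrite !Fa Fb; clear; lia.
apply: (@locally_constant_segment 0 1 (fun s => F s b = F 0 b)) => //.
move=> s s01.
pose P t := forall j, tau j (s, t) -> \forall u \near within `[0, 1]%classic (nbhs s),
  F u t - sigma j (u, t) = F s t - sigma j (s, t).
suff Pb : P b.
  have [|j tj] := ex (s, b); first by split.
  have /near_withinP[e e0 he] := Pb j tj.
  apply/near_withinP; exists e => // u u01 su; have := he u u01 su.
  by rewrite (sb j u u01) (sb j s s01) => /addIr ->.
apply: (@locally_constant_segment a b P) => //; last first.
  move=> j tj; apply/near_withinP; exists 1 => // u u01 _.
  by rewrite !Fa (sa j u u01) (sa j s s01).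
move=> t tab; have [|j tj] := ex (s, t); first by split.
have [|e e0 he] := near_box (op (s, t) j _ tj); first by split.
suff ext u v : u \in `[a, b] -> v \in `[a, b] -> `|t - u| < e -> `|t - v| < e ->
    P u -> P v.
  have tt : `|t - t| < e by rewrite subrr normr0.
  by apply/near_withinP; exists e => // u uab tu; split; exact: ext.
move=> uab vab tu tv Pu k tk.
have ss : `|s - s| < e by rewrite subrr normr0.
have tju : tau j (s, u) by exact: he.
have tjv : tau j (s, v) by exact: he.
have /near_withinP[d d0 hd] := Pu j tju.
have [|d' d'0 hd'] := near_box (cmp (s, v) j k _ tjv tk); first by split.
apply/near_withinP; exists (Num.min e (Num.min d d')).
  by rewrite !lt_min e0 d0.
move=> w w01; rewrite !lt_min => /andP[we /andP[wd wd']].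
have line r : r \in `[0, 1] -> `|s - r| < e ->
    F r v - sigma j (r, v) = F r u - sigma j (r, u).
  move=> r01 sr; apply: (index_function_chart uab vab (Find r r01)) => x xab.
  rewrite ge_min le_max => hx1 hx2; apply: he => //.
  exact: (between_near tu tv).
have := line w w01 we; have := line s s01 ss; have := hd w w01 wd.
have := hd' w v w01 vab wd'; rewrite subrr normr0 => /(_ d'0).
by move: (sigma j (w, v)) (sigma k (w, v)) (sigma j (s, v)) (sigma k (s, v)) (sigma j (w, u))
  (sigma j (s, u)) (F w u) (F s u) (F s v) (F w v); clear => *; lia.
Qed.

(** Subtracting from f the step function that jumps by 2 g x at each x of the
    finite support of g, and takes the middle value at x, leaves a locally
    constant function. The end points only contribute one half of a step. *)
Lemma crossing_count (a b : R) (f g : R -> int) (Q : R -> Prop) : a < b ->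
  (forall t, t \in `[a, b] -> g t != 0 -> Q t) ->
  (forall t, t \in `[a, b] -> \forall u \near within `[a, b]%classic (nbhs t),
     (t < u -> f u = f t + g t /\ g u = 0) /\
     (u < t -> f u = f t - g t /\ g u = 0)) ->
  (g a)%:Q / 2 + \sum_(t \in [set t | a < t < b /\ Q t]) (g t)%:Q + (g b)%:Q / 2
    = (f b - f a)%:Q / 2.
Proof.
move=> ab gQ loc.
have aab : a \in `[a, b] by rewrite in_itv /= lexx ltW.
have bab : b \in `[a, b] by rewrite in_itv /= lexx ltW.
pose P t := exists s : seq R, forall x, a <= x -> x <= t -> g x != 0 -> x \in s.
have [s0 hs0] : P b.
  apply: (@locally_constant_segment a b P) => //; last first.
    by exists [:: a] => x ax xa _; rewrite inE; apply/eqP; lra.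
  move=> t tab; have /near_withinP[e e0 he] := loc t tab.
  suff ext u v : u \in `[a, b] -> v \in `[a, b] -> `|t - u| < e -> `|t - v| < e ->
      P u -> P v.
    have tt : `|t - t| < e by rewrite subrr normr0.
    by apply/near_withinP; exists e => // u uab tu; split; exact: ext.
  rewrite !in_itv /= => /andP[au ub] /andP[av vb] tu tv [s hs].
  exists (t :: s) => x ax xv gx; rewrite inE.
  have [//|xt] := eqVneq x t; have [xu|ux] := leP x u; first exact: hs.
  have xab : x \in `[a, b] by rewrite in_itv /= ax (le_trans xv).
  have tx : `|t - x| < e.
    by apply: (between_near tu tv); rewrite ?(ltW ux) ?xv ?orbT.
  have [h1 h2] := he x xab tx.
  by move: xt gx; rewrite neq_lt => /orP[/h2|/h1] [_ ->]; rewrite eqxx.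
(* a and b are put in front so that their terms can be split off, whether or
   not g vanishes there. *)
pose s' := undup [seq x <- s0 | a < x < b]; pose s := [:: a, b & s'].
have s'ab x : x \in s' -> a < x < b by rewrite mem_undup mem_filter => /andP[].
have us : uniq s.
  rewrite /s /= inE negb_or undup_uniq andbT (lt_eqF ab) /=.
  by apply/andP; split; apply/negP => /s'ab; rewrite !ltxx ?andbF.
have sab x : x \in s -> x \in `[a, b].
  rewrite inE => /predU1P[->//|]; rewrite inE => /predU1P[->//|/s'ab /andP[ax xb]].
  by rewrite in_itv /= !ltW.
have hs x : x \in `[a, b] -> x \notin s -> g x = 0.
  rewrite in_itv /= !inE !negb_or => /andP[ax xb] /and3P[xa xb' xs]; apply/eqP.
  apply: contraNT xs => gx; rewrite mem_undup mem_filter hs0 // andbT.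
  by rewrite !lt_neqAle ax xb eq_sym xa xb'.
clearbody s'.
pose G t := \sum_(x <- s) g x * sgz (t - x).
have fG : f b - G b = f a - G a.
  apply: (@locally_constant_segment a b (fun t => f t - G t = f a - G a)) => //.
  move=> t tab; have /near_withinP[e e0 he] := loc t tab.
  have [d d0 hd] : exists2 d : R, 0 < d & forall x, x \in s -> x != t -> d <= `|t - x|.
    clear -tab; elim: s => [|x s [d d0 hd]]; first by exists 1.
    have [xt|xt] := eqVneq x t.
      by exists d => // y; rewrite inE => /orP[/eqP->|/hd //]; rewrite xt eqxx.
    exists (Num.min d `|t - x|).
      by rewrite lt_min d0 normr_gt0 subr_eq0 eq_sym.
    by move=> y; rewrite inE ge_min => /orP[/eqP->|/hd h /h -> //]; rewrite lexx orbT.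
  apply/near_withinP; exists (Num.min e d); first by rewrite lt_min e0.
  move=> u uab; rewrite lt_min => /andP[tue tud].
  have GE : G u = G t + g t * sgz (u - t).
    have sgE x : x \in s -> x != t -> sgz (u - x) = sgz (t - x).
      move=> xs xt; have := hd x xs xt; move: tud; rewrite ltr_norml => /andP[? ?].
      have [tx|tx|tx] := ltgtP t x; last by rewrite tx eqxx in xt.
        rewrite ltr0_norm ?subr_lt0 // => ?.
        by rewrite !ltr0_sgz //; lra.
      rewrite gtr0_norm ?subr_gt0 // => ?.
      by rewrite !gtr0_sgz //; lra.
    have [ts|ts] := boolP (t \in s).
      rewrite /G !(bigD1_seq t) //= subrr sgz0 mulr0 add0r addrC; congr (_ + _).
      rewrite big_seq_cond [RHS]big_seq_cond; apply: eq_bigr => x /andP[xs xt].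
      by rewrite sgE.
    rewrite (hs t tab ts) mul0r addr0 /G big_seq [RHS]big_seq; apply: eq_bigr => x xs.
    by rewrite sgE //; apply: contraNneq ts => <-.
  suff -> : f u - G u = f t - G t by [].
  have [h1 h2] := he u uab tue; rewrite GE.
  have [tu|ut|->] := ltgtP t u; last by rewrite subrr sgz0 mulr0 addr0.
    by rewrite gtr0_sgz ?subr_gt0 // (h1 tu).1; clear; lia.
  by rewrite ltr0_sgz ?subr_lt0 // (h2 ut).1; clear; lia.
have -> : \sum_(t \in [set t | a < t < b /\ Q t]) (g t)%:Q
    = \sum_(x <- s | a < x < b) (g x)%:Q.
  transitivity (\sum_(t \in [set` (fun t => a < t < b)]) (g t)%:Q).
    apply: fsbig_widen => [t [] //|t /= [atb nQ]].
    have tab : t \in `[a, b] by move: atb; rewrite in_itv /= => /andP[/ltW -> /ltW ->].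
    apply/eqP; rewrite intr_eq0; apply/negPn/negP => /(gQ _ tab) Qt; exact: nQ.
  apply/esym; apply: bigfs => // x /andP[ax xb] xs.
  by rewrite hs // in_itv /= !ltW.
have sumE (h : R -> int) : \sum_(x <- s) g x * h x =
   \sum_(x <- s | a < x < b) g x * h x + g a * h a + g b * h b.
  have s'E : \sum_(x <- s' | a < x < b) g x * h x = \sum_(x <- s') g x * h x.
    rewrite big_seq_cond [RHS]big_seq; apply: eq_bigl => x.
    by apply: andb_idr; exact: s'ab.
  by rewrite /s !big_cons !ltxx andbF /= s'E; ring.
have GbE : G b = \sum_(x <- s | a < x < b) g x + g a.
  rewrite /G (sumE (fun x => sgz (b - x))) subrr sgz0 mulr0 addr0.
  rewrite gtr0_sgz ?subr_gt0 // mulr1; congr (_ + _); apply: eq_bigr => x /andP[_ xb].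
  by rewrite gtr0_sgz ?subr_gt0 // mulr1.
have GaE : G a = - \sum_(x <- s | a < x < b) g x - g b.
  rewrite /G (sumE (fun x => sgz (a - x))) subrr sgz0 mulr0 addr0.
  rewrite ltr0_sgz ?subr_lt0 // mulrN1 -sumrN; congr (_ + _); apply: eq_bigr => x /andP[ax _].
  by rewrite ltr0_sgz ?subr_lt0 // mulrN1.
have -> : f b - f a = g a + \sum_(x <- s | a < x < b) g x *+ 2 + g b.
  rewrite sumrMnl mulr2n; move: fG; rewrite GbE GaE; clear.
  by move: (\sum_(_ <- _ | _) _) (f b) (f a) (g a) (g b) => *; lia.
rewrite sumrMnl mulr2n !intrD rmorph_sum /=; by field.
Qed.

End IndexFunctions.

(** * Bases of subspaces as matrices *)

Section Frames.
Context {R : realType} {N : nat}.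
Implicit Types L W : {vspace 'cV[R]_N}.

Definition is_frame k (Z : 'M[R]_(N, k)) (L : {vspace 'cV[R]_N}) : Prop :=
  (forall v, v \in L <-> exists y, v = Z *m y) /\ (forall y : 'cV[R]_k, Z *m y = 0 -> y = 0).

Definition basis_mx L : 'M[R]_(N, \dim L) := \matrix_(i, j) (vbasis L)`_j i 0.

Lemma basis_mxE L (y : 'cV[R]_(\dim L)) :
  basis_mx L *m y = \sum_j y j 0 *: (vbasis L)`_j.
Proof.
apply/colP => i; rewrite mxE summxE; apply: eq_bigr => j _.
by rewrite !mxE mulrC.
Qed.

Lemma is_frame_basis L : is_frame (basis_mx L) L.
Proof.
split=> [v|y].
  split=> [vL|[y ->]].
    exists (\col_j coord (vbasis L) j v); rewrite basis_mxE {1}(coord_vbasis vL).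
    by apply: eq_bigr => j _; rewrite mxE.
  rewrite basis_mxE; apply: rpred_sum => j _; apply: rpredZ; apply: vbasis_mem.
  by apply: mem_nth; rewrite size_tuple.
rewrite basis_mxE => h; apply/colP => j; rewrite mxE.
by have /freeP /(_ (fun j => y j 0) h j) := basis_free (vbasisP L).
Qed.

Lemma is_frame_factor k l (Z : 'M[R]_(N, k)) (A : 'M[R]_(N, l)) L :
  is_frame Z L -> (forall y, A *m y \in L) -> exists C, A = Z *m C.
Proof.
move=> [ZL _] AL.
have /choice[f hf] : forall j, exists y, col j A = Z *m y.
  by move=> j; apply/ZL; rewrite colE.
exists (\matrix_(i, j) f j i 0); apply/matrixP => i j.
have -> : A i j = col j A i 0 by rewrite mxE.
by rewrite hf !mxE; apply: eq_bigr => p _; rewrite !mxE.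
Qed.

Lemma is_frame_inj k l (Z : 'M[R]_(N, k)) L (C D : 'M[R]_(k, l)) :
  is_frame Z L -> Z *m C = Z *m D -> C = D.
Proof.
move=> [_ Zinj] /eqP; rewrite -subr_eq0 -mulmxBr => /eqP h.
apply/eqP; rewrite -subr_eq0; apply/eqP/matrixP => i j.
have : col j (C - D) = 0.
  by apply: Zinj; rewrite colE mulmxA h mul0mx.
by move=> /colP/(_ i); rewrite !mxE.
Qed.

Lemma is_frame_mem k (Z : 'M[R]_(N, k)) L y : is_frame Z L -> Z *m y \in L.
Proof. by move=> [ZL _]; apply/ZL; exists y. Qed.

Lemma is_frame_change k l (Z : 'M[R]_(N, k)) (Y : 'M[R]_(N, l)) L :
  is_frame Z L -> is_frame Y L -> exists C D,
    [/\ Y = Z *m C, Z = Y *m D, C *m D = 1%:M & D *m C = 1%:M].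
Proof.
move=> hZ hY.
have [C YE] := is_frame_factor hZ (fun y => is_frame_mem y hY).
have [D ZE] := is_frame_factor hY (fun y => is_frame_mem y hZ).
exists C, D; split=> //.
  by apply: (is_frame_inj hZ); rewrite mulmxA -YE -ZE mulmx1.
by apply: (is_frame_inj hY); rewrite mulmxA -ZE -YE mulmx1.
Qed.

Lemma square_of_inverses k l (C : 'M[R]_(k, l)) D :
  C *m D = 1%:M -> D *m C = 1%:M -> k = l.
Proof.
move=> CD DC; apply/eqP; rewrite eqn_leq; apply/andP; split.
  by rewrite -{1}(mxrank1 R k) -CD (leq_trans (mxrankM_maxl _ _)) ?rank_leq_col.
by rewrite -{1}(mxrank1 R l) -DC (leq_trans (mxrankM_maxl _ _)) ?rank_leq_col.
Qed.

Lemma is_frame_dim k (Z : 'M[R]_(N, k)) L : is_frame Z L -> \dim L = k.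
Proof.
move=> hZ; have [C [D [_ _ CD DC]]] := is_frame_change (is_frame_basis L) hZ.
exact: square_of_inverses CD DC.
Qed.

Lemma is_frame_exists k L : \dim L = k -> exists Z : 'M[R]_(N, k), is_frame Z L.
Proof. by move=> <-; exists (basis_mx L); exact: is_frame_basis. Qed.

Lemma is_frame_dimP k (Z : 'M[R]_(N, k)) L : \dim L = k ->
  (forall v, v \in L <-> exists y, v = Z *m y) -> is_frame Z L.
Proof.
move=> dL ZL; split=> // y Zy; have [Y hY] := is_frame_exists dL.
have [C ZE] : exists C, Z = Y *m C.
  by apply: (is_frame_factor hY) => x; apply/ZL; exists x.
have [D YE] : exists D, Y = Z *m D.
  have /choice[f hf] : forall j, exists y, col j Y = Z *m y.
    by move=> j; apply/ZL; rewrite colE; exact: is_frame_mem.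
  exists (\matrix_(i, j) f j i 0); apply/matrixP => i j.
  have -> : Y i j = col j Y i 0 by rewrite mxE.
  by rewrite hf !mxE; apply: eq_bigr => p _; rewrite !mxE.
have CD : C *m D = 1%:M.
  by apply: (is_frame_inj hY); rewrite mulmxA -ZE -YE mulmx1.
have DC := mulmx1C CD.
have := congr1 (mulmx D) (_ : C *m y = 0); rewrite mulmxA DC mul1mx mulmx0; apply.
by apply: (hY.2); rewrite mulmxA -ZE.
Qed.

Lemma mx_formE k l (A : 'M[R]_(N, k)) (M : 'M[R]_N) (B : 'M[R]_(N, l)) i j :
  (A^T *m M *m B) i j = ((col i A)^T *m M *m col j B) 0 0.
Proof.
rewrite !colE trmx_mul trmx_delta.
have -> : delta_mx 0 i *m A^T *m M *m (B *m delta_mx j 0)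
    = (delta_mx 0 i : 'rV_k) *m (A^T *m M *m B) *m (delta_mx j 0 : 'cV_l).
  by rewrite !mulmxA.
by rewrite -rowE -colE !mxE.
Qed.

(** Sylvester's law makes the choice of the basis irrelevant. *)
Lemma signature_frame k (Z : 'M[R]_(N, k)) L (q : 'cV[R]_N -> 'cV[R]_N -> R)
    (M : 'M[R]_N) : is_frame Z L ->
  (forall u v, u \in L -> v \in L -> q u v = (u^T *m M *m v) 0 0) ->
  (Z^T *m M *m Z)^T = Z^T *m M *m Z ->
  signature L q = mx_signature (Z^T *m M *m Z).
Proof.
move=> hZ qE Zsym; have [C [D [BE ZE CD DC]]] := is_frame_change hZ (is_frame_basis L).
have -> : signature L q = mx_signature ((basis_mx L)^T *m M *m basis_mx L).
  congr mx_signature; apply/matrixP => i j; rewrite mxE.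
  have bcol (l : 'I_(\dim L)) : (vbasis L)`_l = col l (basis_mx L).
    by apply/colP => p; rewrite !mxE.
  rewrite mx_formE -!bcol; apply: qE; apply: vbasis_mem; apply: mem_nth.
    by rewrite size_tuple.
  by rewrite size_tuple.
have BMB : (basis_mx L)^T *m M *m basis_mx L = C^T *m (Z^T *m M *m Z) *m C.
  by rewrite BE trmx_mul !mulmxA.
apply/esym; apply: (@mx_signature_congr _ _ _ _ _ C D) => //.
by rewrite {1 2}ZE trmx_mul !mulmxA.
Qed.

End Frames.

(** * Signatures of a Lagrangian subspace in the charts W_j *)

Section LagrangianCharts.
Context {R : realType} {m : nat}.
Variables (Om : 'M[R]_(m + m)) (al be : 'M[R]_(m, m + m)).
Implicit Types Lam : {vspace 'cV[R]_(m + m)}.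

(** al and be are Darboux coordinates; the reference Lagrangian is ker be. *)
Definition darboux : Prop :=
  Om = al^T *m be - be^T *m al /\ col_mx al be \in unitmx.

(** The kernels W_j of al - j be are Lagrangian complements of ker be. *)
Definition chart_coord (j : nat) : 'M[R]_(m, m + m) := al - j%:R *: be.

Definition chart_matrix (j : nat) (Z : 'M[R]_(m + m, m)) : 'M[R]_m :=
  (chart_coord j *m Z)^T *m (be *m Z).

Definition transverse (j : nat) Lam : Prop :=
  forall v, v \in Lam -> chart_coord j *m v = 0 -> v = 0.

(** If Lam is transverse to W_j it is the graph of a map from ker be to W_j, and
    this is the signature of the quadratic form of that map, read on Lam. *)
Definition chart_signature (j : nat) Lam : int :=
  signature Lam (fun u v => (u^T *m ((chart_coord j)^T *m be) *m v) 0 0).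

Hypothesis Om_darboux : darboux.

Lemma darboux_inj k (Z : 'M[R]_(m + m, k)) : al *m Z = 0 -> be *m Z = 0 -> Z = 0.
Proof.
move=> aZ bZ; have [_ u] := Om_darboux.
by rewrite -[Z](mulKmx u) mul_col_mx aZ bZ col_mx0 mulmx0.
Qed.

Lemma darboux_shift j : Om = (chart_coord j)^T *m be - be^T *m chart_coord j.
Proof.
have [-> _] := Om_darboux.
rewrite /chart_coord [(al - _)^T]linearB /= [(_ *: be)^T]linearZ /= mulmxBl mulmxBr.
by rewrite -scalemxAl -scalemxAr opprB addrA subrK.
Qed.

Lemma lagrangian_dim Lam : lagrangian Om Lam -> \dim Lam = m.
Proof. by case=> _ e; apply: double_inj; rewrite e addnn. Qed.

Lemma lagrangian_frame Lam : lagrangian Om Lam ->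
  exists Z : 'M[R]_(m + m, m), is_frame Z Lam.
Proof. by move=> /lagrangian_dim; exact: is_frame_exists. Qed.

Lemma lagrangian_isotropic k l (Z : 'M[R]_(m + m, k)) (Y : 'M[R]_(m + m, l)) Lam :
  lagrangian Om Lam -> is_frame Z Lam -> is_frame Y Lam -> Z^T *m Om *m Y = 0.
Proof.
move=> [iso _] hZ hY; apply/matrixP => i j; rewrite mx_formE [RHS]mxE.
by apply: iso; rewrite colE; exact: is_frame_mem.
Qed.

Lemma lagrangian_sym j (Z : 'M[R]_(m + m, m)) Lam :
  lagrangian Om Lam -> is_frame Z Lam ->
  (chart_matrix j Z)^T = chart_matrix j Z.
Proof.
rewrite /chart_matrix => lag hZ; have := lagrangian_isotropic lag hZ hZ.
rewrite (darboux_shift j) mulmxBr mulmxBl => /eqP; rewrite subr_eq0 => /eqP.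
by rewrite !trmx_mul !trmxK !mulmxA => ->.
Qed.

Lemma transverseP j (Z : 'M[R]_(m + m, m)) Lam : is_frame Z Lam ->
  transverse j Lam <-> chart_coord j *m Z \in unitmx.
Proof.
move=> hZ; split=> [h|u v vL cv].
  apply: unitmx_inj => y; rewrite -mulmxA => cZy.
  by apply: hZ.2; apply: h => //; exact: is_frame_mem.
have [y vE] := (hZ.1 v).1 vL; rewrite vE.
have : chart_coord j *m Z *m y = 0 by rewrite -mulmxA -vE.
move=> /(congr1 (mulmx (invmx (chart_coord j *m Z)))); rewrite mulKmx //.
by rewrite mulmx0 => ->; rewrite mulmx0.
Qed.

Lemma chart_signatureE j (Z : 'M[R]_(m + m, m)) Lam :
  lagrangian Om Lam -> is_frame Z Lam ->
  chart_signature j Lam = mx_signature (chart_matrix j Z).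
Proof.
rewrite /chart_matrix => lag hZ.
have E : Z^T *m ((chart_coord j)^T *m be) *m Z = (chart_coord j *m Z)^T *m (be *m Z).
  by rewrite trmx_mul !mulmxA.
rewrite -E; apply: signature_frame => //.
by rewrite E; exact: (lagrangian_sym j lag hZ).
Qed.

(** If all of W_0, ..., W_m met Lam, there would be nonzero y_j in Lam with
    al y_j = j be y_j; the vectors be y_j would be m + 1 nonzero and, as Lam is
    isotropic, pairwise orthogonal vectors of R^m. *)
Lemma transverse_exists Lam : lagrangian Om Lam -> exists j, transverse j Lam.
Proof.
move=> lag; apply: contrapT => nex; have [Z hZ] := lagrangian_frame lag.
have /choice[y hy] : forall j : nat, exists v : 'cV[R]_(m + m),
    [/\ v \in Lam, al *m v = j%:R *: (be *m v) & v != 0].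
  move=> j; apply: contrapT => nv; apply: nex; exists j => v vL cv.
  apply/eqP; apply: contrapT => /negP v0; apply: nv; exists v; split=> //.
  by apply/eqP; rewrite -subr_eq0 scalemxAl -mulmxBl; apply/eqP.
pose W := \matrix_(i < m, j < m.+1) (be *m y j) i 0.
have [x x0 Wx] := wide_kernel W (ltnSn m).
have orth (i j : nat) : i != j -> ((be *m y i)^T *m (be *m y j)) 0 0 = 0.
  move=> ij; have [yiL ai _] := hy i; have [yjL aj _] := hy j.
  have : sform Om (y i) (y j) = 0 by exact: lag.1.
  rewrite /sform Om_darboux.1 mulmxBr mulmxBl.
  have -> : (y i)^T *m (al^T *m be) *m y j = i%:R *: ((be *m y i)^T *m (be *m y j)).
    by rewrite !mulmxA -trmx_mul ai [(_ *: _)^T]linearZ /= -!scalemxAl.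
  have -> : (y i)^T *m (be^T *m al) *m y j = j%:R *: ((be *m y i)^T *m (be *m y j)).
    by rewrite -!mulmxA aj trmx_mul -!scalemxAr !mulmxA.
  rewrite -scalerBl mxE => /eqP; rewrite mulf_eq0 subr_eq0 eqr_nat (negPf ij) /=.
  by move/eqP.
move/eqP: x0; apply; apply/colP => j; rewrite [RHS]mxE.
have bj0 : be *m y j != 0.
  have [_ aj yj0] := hy j; apply: contra_neq yj0 => bj.
  by apply: darboux_inj; rewrite // aj bj scaler0.
have : ((be *m y j)^T *m (W *m x)) 0 0 = 0 by rewrite Wx mulmx0 mxE.
rewrite mulmxA mxE (bigD1 j) //= big1 ?addr0.
  have -> : ((be *m y j)^T *m W) 0 j = ((be *m y j)^T *m (be *m y j)) 0 0.
    by rewrite !mxE; apply: eq_bigr => i _; rewrite !mxE.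
  by move=> /eqP; rewrite mulf_eq0 sqr_cV_eq0 (negPf bj0) => /eqP.
move=> i ij; have -> : ((be *m y j)^T *m W) 0 i = ((be *m y j)^T *m (be *m y i)) 0 0.
  by rewrite !mxE; apply: eq_bigr => l _; rewrite !mxE.
by rewrite orth ?mul0r // eq_sym.
Qed.

Lemma chart_coordD j d (Z : 'M[R]_(m + m, m)) :
  chart_coord (j + d) *m Z = chart_coord j *m Z - d%:R *: (be *m Z).
Proof.
by rewrite /chart_coord natrD scalerDl opprD addrA mulmxBl -scalemxAl.
Qed.

Section Continuity.
Context {X : topologicalType}.
Variables (D : set X) (H : X -> {vspace 'cV[R]_(m + m)}).
Hypothesis H_cont : lagrangian_continuous Om D H.

Definition end_mx (f : 'End('cV[R]_(m + m))) : 'M[R]_(m + m) :=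
  \matrix_(i, j) f (col j 1%:M) i 0.

Lemma end_mxE (f : 'End('cV[R]_(m + m))) (v : 'cV[R]_(m + m)) : f v = end_mx f *m v.
Proof.
have {1}-> : v = \sum_j v j 0 *: col j 1%:M.
  apply/colP => i; rewrite summxE (bigD1 i) //= big1 => [|j ji]; rewrite !mxE.
    by rewrite eqxx mulr1 addr0.
  by rewrite eq_sym (negPf ji) mulr0.
rewrite linear_sum; apply/colP => i; rewrite summxE mxE; apply: eq_bigr => j _.
by rewrite linearZ !mxE mulrC.
Qed.

Definition chart_frame (f : 'End('cV[R]_(m + m))) (Z : 'M[R]_(m + m, m)) :=
  Z + end_mx f *m Z.

Lemma chart_frameP (f : 'End('cV[R]_(m + m))) (Z : 'M[R]_(m + m, m)) Lam Lam' :
  is_frame Z Lam -> Lam' = ((\1 + f)%VF @: Lam)%VS -> lagrangian Om Lam' ->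
  is_frame (chart_frame f Z) Lam'.
Proof.
move=> hZ L'E lag; apply: is_frame_dimP; first exact: lagrangian_dim.
have ZyE y : chart_frame f Z *m y = (\1 + f)%VF (Z *m y).
  by rewrite add_lfunE id_lfunE end_mxE mulmxDl mulmxA.
move=> v; rewrite L'E; split.
  move=> /memv_imgP[u uL ->]; have [y ->] := (hZ.1 u).1 uL.
  by exists y; rewrite ZyE.
by move=> [y ->]; rewrite ZyE; apply: memv_img; exact: is_frame_mem.
Qed.

Lemma nearW_within (x : X) (P : X -> Prop) : D x ->
  (\forall y \near within D (nbhs x), P y) -> P x.
Proof. by move=> Dx h; exact: (nbhs_singleton h Dx). Qed.

Lemma near_within_D (x : X) : \forall y \near within D (nbhs x), D y.
Proof. exact: withinT. Qed.

Lemma continuous_frame x0 : D x0 -> exists Z : X -> 'M[R]_(m + m, m),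
  (\forall x \near within D (nbhs x0), is_frame (Z x) (H x)) /\
  mx_cvg (within D (nbhs x0)) Z (Z x0).
Proof.
move=> Dx0; have [lag0 [W [a [_ gr cv]]]] := H_cont Dx0.
have [Z0 hZ0] := lagrangian_frame lag0.
exists (fun x => chart_frame (a x) Z0); split.
  apply: filterS2 gr (near_within_D x0) => x [_ HE] Dx.
  by apply: (chart_frameP hZ0 HE); exact: (H_cont Dx).1.
apply: mx_cvgD; first exact: mx_cvg_cst.
move=> i j.
have colZ : col j Z0 \in H x0 by rewrite colE; exact: is_frame_mem.
have E (f : 'End('cV[R]_(m + m))) : (end_mx f *m Z0) i j = f (col j Z0) i 0.
  by rewrite end_mxE colE mulmxA -colE !mxE.
rewrite E; under eq_fun do rewrite E.
have h := cv _ colZ.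
exact: (cvg_comp (fun x => a x (col j Z0)) (fun M : 'cV[R]_(m + m) => M i 0) h
  (@coord_continuous R (m + m) 1 i 0 _)).
Qed.

(** The open condition is the invertibility of the matrix of the projection of
    Lam to ker be along W_j. *)
Lemma transverse_open x j : D x -> transverse j (H x) ->
  \forall y \near within D (nbhs x), transverse j (H y).
Proof.
move=> Dx tj; have [Z [hZ Zc]] := continuous_frame Dx.
have cu : chart_coord j *m Z x \in unitmx.
  by apply/(transverseP j (nearW_within Dx hZ)).
have cc : mx_cvg (within D (nbhs x)) (fun y => chart_coord j *m Z y) (chart_coord j *m Z x).
  by apply: mx_cvg_mul => //; exact: mx_cvg_cst.
have cn : \forall y \near within D (nbhs x), chart_coord j *m Z y \in unitmx.
  exact: near_unitmx cc cu.
by apply: filterS2 hZ cn => y hZy cy; apply/(transverseP j hZy).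
Qed.

(** For j < k the difference is m minus the signature of c_j^T c_k, where c_i is the matrix
    of al - i be on Lam. That matrix is invertible as long as Lam is transverse
    to both W_j and W_k, so its signature is locally constant. *)
Lemma chart_signature_compare x j k : D x -> transverse j (H x) -> transverse k (H x) ->
  \forall y \near within D (nbhs x),
    chart_signature j (H y) - chart_signature k (H y)
      = chart_signature j (H x) - chart_signature k (H x).
Proof.
move=> Dx; wlog jk : j k / (j < k)%N.
  move=> hw tj tk; have [jk|kj|->] := ltngtP j k; first exact: hw.
    by apply: filterS (hw k j kj tk tj) => y; clear; lia.
  by apply: filterE => y; rewrite !subrr.
move=> tj tk; have [Z [hZ Zc]] := continuous_frame Dx.
have hZx := nearW_within Dx hZ.
pose c i y := chart_coord i *m Z y.
have cc i : mx_cvg (within D (nbhs x)) (c i) (c i x).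
  by apply: mx_cvg_mul => //; exact: mx_cvg_cst.
have key y : D y -> is_frame (Z y) (H y) -> transverse j (H y) -> transverse k (H y) ->
    ((c j y)^T *m c k y)^T = (c j y)^T *m c k y /\
    chart_signature j (H y) - chart_signature k (H y)
      = m%:Z - mx_signature ((c j y)^T *m c k y).
  move=> Dy hZy tjy tky; have lag := (H_cont Dy).1.
  have ckE : c k y = c j y - (k - j)%:R *: (be *m Z y).
    by rewrite -chart_coordD subnKC // ltnW.
  have bsym := lagrangian_sym j lag hZy.
  split.
    rewrite ckE mulmxBr -scalemxAr [LHS]linearB /= [(_ *: _)^T]linearZ /= bsym.
    by rewrite trmx_mul trmxK.
  rewrite !(chart_signatureE _ lag hZy); apply: mx_signature_shift ckE _ _ => //.
  - by rewrite ltr0n subn_gt0.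
  - exact/(transverseP j hZy).
  - exact/(transverseP k hZy).
have [sx ->] := key x Dx hZx tj tk.
have cu : (c j x)^T *m c k x \in unitmx.
  by rewrite unitmx_mul unitmx_tr; apply/andP; split; apply/(transverseP _ hZx).
have near_all : \forall y \near within D (nbhs x),
    [/\ D y, is_frame (Z y) (H y), transverse j (H y) & transverse k (H y)].
  apply: filterS3 (near_within_D x) hZ
    (filterI (transverse_open Dx tj) (transverse_open Dx tk)).
  by move=> y Dy hZy [? ?].
have near_sym : \forall y \near within D (nbhs x), ((c j y)^T *m c k y)^T = (c j y)^T *m c k y.
  by apply: filterS near_all => y [? ? ? ?]; apply: (key y _ _ _ _).1.
have near_sg : \forall y \near within D (nbhs x),
    mx_signature ((c j y)^T *m c k y) = mx_signature ((c j x)^T *m c k x)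
    /\ (c j y)^T *m c k y \in unitmx.
  by apply: mx_signature_cvg => //; apply: mx_cvg_mul => //; exact: mx_cvg_tr.
apply: filterS2 near_all near_sg => y [Dy hy tjy tky] [sg _].
by rewrite (key y Dy hy tjy tky).2 sg.
Qed.

Lemma lagrangian_chart_system :
  chart_system D (fun j x => transverse j (H x)) (fun j x => chart_signature j (H x)).
Proof.
split=> [x Dx|x j|x j k].
- exact/transverse_exists/(H_cont Dx).1.
- exact: transverse_open.
- exact: chart_signature_compare.
Qed.

End Continuity.

End LagrangianCharts.

(** * The jump of a chart signature at a regular crossing *)

Section PuncturedSegment.
Context {R : realType} {a b : R}.
Local Notation D := (`[a, b]%classic : set R).

Lemma near_punctured_within (t : R) (P : R -> Prop) :
  (\forall x \near within D t^', P x) <->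
  exists2 e : R, 0 < e & forall x, x \in `[a, b] -> `|t - x| < e -> x != t -> P x.
Proof.
split=> [/nbhs_ballP[e /= e0 h]|[e e0 h]].
  by exists e => // x xab xt xnt; apply: h.
apply/nbhs_ballP; exists e => //= x xt xnt xab; exact: h.
Qed.

Lemma near_punctured (t : R) (P : R -> Prop) :
  (\forall x \near within D (nbhs t), P x) -> \forall x \near within D t^', P x.
Proof.
move=> /near_withinP[e e0 h]; apply/near_punctured_within.
by exists e => // x xab tx _; exact: h.
Qed.

Lemma punctured_proper (t : R) : a < b -> t \in `[a, b] -> ProperFilter (within D t^').
Proof.
move=> ab tab; apply: Build_ProperFilter => /near_punctured_within[e e0 h].
move: tab; rewrite in_itv /= => /andP[at_ tb].
have [tb'|bt] := ltP t b.
  pose d := Num.min (e / 2) (b - t).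
  have d0 : 0 < d by rewrite lt_min divr_gt0 // subr_gt0.
  have [de db] : d <= e / 2 /\ d <= b - t by rewrite !ge_min !lexx orbT.
  apply: (h (t + d)); first by rewrite in_itv /=; apply/andP; split; lra.
    by rewrite opprD addrA subrr sub0r normrN gtr0_norm //; lra.
  by rewrite -subr_eq0 addrAC subrr add0r gt_eqF.
pose d := Num.min (e / 2) (t - a).
have d0 : 0 < d by rewrite lt_min divr_gt0 //= subr_gt0 (lt_le_trans ab bt).
have [de db] : d <= e / 2 /\ d <= t - a by rewrite !ge_min !lexx orbT.
apply: (h (t - d)); first by rewrite in_itv /=; apply/andP; split; lra.
  by rewrite opprB addrC subrK gtr0_norm //; lra.
by rewrite -subr_eq0 addrAC subrr add0r oppr_eq0 gt_eqF.
Qed.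

Lemma derivable_quotient (f : R -> R) (t : R) : derivable f t 1 ->
  exists l : R, ((x - t)^-1 * (f x - f t) @[x --> within D t^']) --> l.
Proof.
move=> /cvg_ex[/= l /cvgrPdist_lt hl]; exists l; apply/cvgrPdist_lt => e e0.
have /nbhs_ballP[d /= d0 hd] := hl e e0.
apply/near_punctured_within; exists d => // x xab tx xt.
have := hd (x - t); rewrite /ball /= sub0r normrN distrC => /(_ tx).
rewrite subr_eq0 => /(_ xt).
by rewrite /GRing.scale /= mulr1 subrK.
Qed.

Lemma punctured_cvg (t : R) : (fun x : R => x - t) @ within D t^' --> (0 : R).
Proof.
apply/cvgrPdist_lt => e e0; apply/near_punctured_within; exists e => // x _ tx _.
by rewrite sub0r opprB.
Qed.

Lemma quotient_cvg k l (t : R) (Z : R -> 'M[R]_(k, l)) Z' :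
  mx_cvg (within D t^') (fun x => (x - t)^-1 *: (Z x - Z t)) Z' ->
  mx_cvg (within D t^') Z (Z t).
Proof.
move=> hZ; apply: (@mx_cvg_eq _ _ _ _ _ _
  (fun x => (x - t) *: ((x - t)^-1 *: (Z x - Z t)) + Z t)).
  apply/near_punctured_within; exists 1 => // x _ _ xt.
  by rewrite scalerA divff ?subr_eq0 // scale1r subrK.
rewrite -[X in mx_cvg _ _ X]add0r; apply: mx_cvgD; last exact: mx_cvg_cst.
by rewrite -(scale0r Z'); apply: mx_cvgZ => //; exact: punctured_cvg.
Qed.

(** Apply the perturbation lemma on each side of t, with h the distance to t;
    on the left the difference quotients change sign, hence so does the form
    on the kernel. *)
Lemma mx_signature_jump m k (t : R) (S : R -> 'M[R]_m) (S' : 'M[R]_m) (K : 'M[R]_(m, k)) :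
  t \in `[a, b] ->
  (\forall x \near within D (nbhs t), (S x)^T = S x) ->
  mx_cvg (within D t^') (fun x => (x - t)^-1 *: (S x - S t)) S' ->
  row_free K^T -> S t *m K = 0 ->
  (forall v : 'cV[R]_m, S t *m v = 0 -> exists y : 'cV[R]_k, v = K *m y) ->
  (K^T *m S' *m K)^T = K^T *m S' *m K -> K^T *m S' *m K \in unitmx ->
  \forall x \near within D (nbhs t),
    (t < x -> mx_signature (S x) = mx_signature (S t) + mx_signature (K^T *m S' *m K)
       /\ S x \in unitmx) /\
    (x < t -> mx_signature (S x) = mx_signature (S t) - mx_signature (K^T *m S' *m K)
       /\ S x \in unitmx).
Proof.
move=> tab Ssym Sd Kfree SK Kker Gsym Gu.
have St : (S t)^T = S t := @nearW_within _ D t _ tab Ssym.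
have side (e : R) : `|e| = 1 -> \forall x \near within D (nbhs t), 0 < e * (x - t) ->
    mx_signature (S x) = mx_signature (S t) + mx_signature (e *: (K^T *m S' *m K))
    /\ S x \in unitmx.
  move=> e1; pose F := within (D `&` [set x | 0 < e * (x - t)]) (nbhs t).
  have FF : Filter F by exact: within_filter.
  have e0 : e != 0 by rewrite -normr_eq0 e1 oner_eq0.
  have ee : e * e = 1 by rewrite -expr2 -real_normK ?num_real // e1 expr1n.
  have subF (P : R -> Prop) : (\forall x \near within D t^', P x) -> \forall x \near F, P x.
    move=> /near_punctured_within[d d0 hd]; apply/nbhs_ballP; exists d => // x tx [xD ex].
    by apply: hd => //; apply: contraTneq ex => ->; rewrite subrr mulr0 ltxx.
  have -> : e *: (K^T *m S' *m K) = K^T *m (e *: S') *m K by rewrite -scalemxAr -scalemxAl.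
  have : \forall x \near F,
    mx_signature (S x) = mx_signature (S t) + mx_signature (K^T *m (e *: S') *m K)
    /\ S x \in unitmx.
    apply: (@mx_signature_perturb _ _ _ _ _ _ (fun x => e * (x - t))) => //.
    - by apply: filterS (withinT _ _) => x [].
    - rewrite -(mulr0 e); apply: cvgM; first exact: cvg_cst.
      by apply: cvg_trans (punctured_cvg t) => P; exact: subF.
    - by apply: subF; exact: near_punctured.
    - have Fd : mx_cvg (within D t^') (fun x => e *: ((x - t)^-1 *: (S x - S t))) (e *: S').
        by apply: mx_cvgZ => //; exact: cvg_cst.
      apply: (@mx_cvg_eq _ _ _ _ _ _ (fun x => e *: ((x - t)^-1 *: (S x - S t)))).
        apply: filterE => x; rewrite scalerA; congr (_ *: _).
        by rewrite invfM; congr (_ * _); apply: (mulfI e0); rewrite ee divff.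
      by move=> i l; apply: cvg_trans (Fd i l) => P; exact: subF.
    - by rewrite -scalemxAr -scalemxAl linearZ /= Gsym.
    - by rewrite -scalemxAr -scalemxAl unitmxZ // unitfE.
  move=> /nbhs_ballP[d /= d0 hd]; apply/near_withinP; exists d => // x xD tx ex.
  exact: (hd x tx (conj xD ex)).
have right := side 1 (normr1 _).
have left : \forall x \near within D (nbhs t), 0 < -1 * (x - t) ->
    mx_signature (S x) = mx_signature (S t) + mx_signature (-1 *: (K^T *m S' *m K))
    /\ S x \in unitmx.
  by apply: side; rewrite normrN1.
apply: filterS2 right left => x; rewrite scale1r mul1r subr_gt0 => right.
by rewrite scaleN1r mulN1r oppr_gt0 subr_lt0 mx_signatureN.
Qed.

End PuncturedSegment.

Section SmoothPaths.
Context {R : realType} {m : nat}.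
Variables (Om : 'M[R]_(m + m)) (al be : 'M[R]_(m, m + m)).
Hypothesis Om_darboux : darboux Om al be.
Variables (a b : R) (Lam : R -> {vspace 'cV[R]_(m + m)}).
Hypothesis ab : a < b.
Local Notation D := (`[a, b]%classic : set R).
Hypothesis Lam_smooth : lagrangian_smooth Om D Lam.

Lemma smooth_frame t : t \in `[a, b] -> exists (Z : R -> 'M[R]_(m + m, m)) Z',
  [/\ \forall x \near within D (nbhs t), is_frame (Z x) (Lam x),
      is_frame (Z t) (Lam t) &
      mx_cvg (within D t^') (fun x => (x - t)^-1 *: (Z x - Z t)) Z'].
Proof.
move=> tab; have [lag0 [W [f [_ gr sm]]]] := Lam_smooth tab.
have [Z0 hZ0] := lagrangian_frame lag0.
pose Z x := chart_frame (f x) Z0.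
have hZ : \forall x \near within D (nbhs t), is_frame (Z x) (Lam x).
  apply: filterS2 gr (near_within_D D t) => x [_ HE] Dx.
  by apply: (chart_frameP hZ0 HE); exact: (Lam_smooth Dx).1.
have ZE x i j : Z x i j = Z0 i j + f x (col j Z0) i 0.
  by rewrite /Z /chart_frame mxE; congr (_ + _); rewrite end_mxE colE mulmxA -colE !mxE.
have : forall ij : 'I_(m + m) * 'I_m, exists l : R,
    ((x - t)^-1 * (Z x ij.1 ij.2 - Z t ij.1 ij.2) @[x --> within D t^']) --> l.
  move=> [i j] /=.
  have colZ : col j Z0 \in Lam t by rewrite colE; exact: is_frame_mem.
  have [g gs fg] := sm _ colZ; have gd : derivable g t 1 := gs 0%N t.
  have /(@derivable_quotient R a b)[l hl] := (derivable_mxP _ _ _).1 gd i 0.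
  exists l; apply: cvg_trans hl; apply: near_eq_cvg.
  have fgt : f t (col j Z0) = g t := @nearW_within _ D t _ tab fg.
  apply: filterS (near_punctured fg) => x fgx.
  by rewrite !ZE fgx fgt; congr (_ * _); ring.
move=> /choice[l hl]; clearbody Z; exists Z, (\matrix_(i, j) l (i, j)); split=> //.
  exact: (@nearW_within _ D t _ tab hZ).
move=> i j; rewrite mxE; under eq_fun do rewrite !mxE.
exact: (hl (i, j)).
Qed.

Lemma complement_coord (L W : {vspace 'cV[R]_(m + m)}) (Z : 'M[R]_(m + m, m)) :
  is_frame Z L -> lagrangian_complement Om L W ->
  exists P : 'M[R]_(m, m + m), P *m Z = 1%:M /\ forall w, w \in W -> P *m w = 0.
Proof.
move=> hZ [lagW _ LW0]; have [Y hY] := lagrangian_frame lagW.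
pose K := row_mx Z Y.
have Ku : K \in unitmx.
  apply: unitmx_inj => x; rewrite -[x]vsubmxK /K mul_row_col => h.
  have ZY : Z *m usubmx x = - (Y *m dsubmx x) by apply/eqP; rewrite -addr_eq0 h.
  have : Z *m usubmx x \in (L :&: W)%VS.
    rewrite memv_cap; apply/andP; split; first exact: is_frame_mem.
    by rewrite ZY memvN; exact: is_frame_mem.
  rewrite LW0 memv0 => /eqP Z0; have u0 := hZ.2 _ Z0.
  move: ZY; rewrite Z0 => /eqP; rewrite eq_sym oppr_eq0 => /eqP /hY.2 d0.
  by rewrite u0 d0 col_mx0.
exists (usubmx (invmx K)).
have : invmx K *m K = 1%:M by exact: mulVmx.
rewrite -{1}[invmx K]vsubmxK /K mul_col_row scalar_mx_block => /eq_block_mx[uZ uY _ _].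
split=> // w /(hY.1 w).1 [y ->].
by rewrite mulmxA uY mul0mx.
Qed.

(** Let P be the coordinates on Lam_t along W. Whatever the chart f,
    f_x Z_t = Z_x (P Z_x)^-1 - Z_t. As Om vanishes on Lam_t, only Z_x - Z_t
    contributes to Om(v, f_x Z_t y), and (P Z_x)^-1 tends to the identity:
    the difference quotient has the same limit in all charts. *)
Lemma velocity_formE t (Z : R -> 'M[R]_(m + m, m)) Z' v y :
  t \in `[a, b] ->
  (\forall x \near within D (nbhs t), is_frame (Z x) (Lam x)) ->
  mx_cvg (within D t^') (fun x => (x - t)^-1 *: (Z x - Z t)) Z' ->
  v \in Lam t ->
  velocity_form Om D Lam t v (Z t *m y) = (v^T *m Om *m Z' *m y) 0 0.
Proof.
move=> tab hZ Zd vL.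
have hZt : is_frame (Z t) (Lam t) := @nearW_within _ D t _ tab hZ.
have lagt := (Lam_smooth tab).1.
have Zc := quotient_cvg Zd.
have key W f : lagrangian_complement Om (Lam t) W -> graph_chart D Lam t W f ->
    derive_within D (fun x => sform Om v (f x (Z t *m y))) t = (v^T *m Om *m Z' *m y) 0 0.
  move=> compl gr; have [P [PZ PW]] := complement_coord hZt compl.
  have vZ : v^T *m Om *m Z t = 0.
    apply/matrixP => i j; rewrite [RHS]mxE !ord1.
    rewrite mx_formE (_ : col 0 v = v); last by apply/colP => q; rewrite mxE.
    apply: lagt.1 => //.
    by rewrite colE; exact: is_frame_mem.
  have fE : \forall x \near within D (nbhs t),
      sform Om v (f x (Z t *m y)) = (v^T *m Om *m (Z x - Z t) *m invmx (P *m Z x) *m y) 0 0.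
    apply: filterS3 gr hZ (near_within_D D t) => x [fW LE] hZx Dx.
    have fZ : end_mx (f x) *m Z t = chart_frame (f x) (Z t) - Z t.
      by rewrite /chart_frame addrAC subrr add0r.
    have Pf : P *m (end_mx (f x) *m Z t) = 0.
      apply/matrixP => i j.
      have -> : (P *m (end_mx (f x) *m Z t)) i j = (P *m (f x (col j (Z t)))) i 0.
        by rewrite end_mxE [col j (Z t)]colE !mulmxA -colE [RHS]mxE.
      rewrite PW ?mxE //; apply: (subvP fW); apply: memv_img.
      by rewrite colE; exact: is_frame_mem.
    have hC := chart_frameP hZt LE (Lam_smooth Dx).1.
    have [g CE] := is_frame_factor hZx (fun y => is_frame_mem y hC).
    have PZg : P *m Z x *m g = 1%:M.
      by rewrite -mulmxA -CE /chart_frame mulmxDr Pf addr0.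
    have gE : g = invmx (P *m Z x).
      have [u _] := mulmx1_unit PZg.
      by rewrite -[g](mulKmx u) PZg mulmx1.
    rewrite /sform end_mxE (mulmxA (end_mx (f x))) fZ CE gE.
    rewrite !mulmxA; congr (fun_of_matrix _ _ _); congr (_ *m _).
    by rewrite !mulmxBr !mulmxBl !mulmxA vZ mul0mx !subr0.
  have ft : sform Om v (f t (Z t *m y)) = 0.
    by rewrite (@nearW_within _ D t _ tab fE) subrr mulmx0 !mul0mx mxE.
  have PF := punctured_proper ab tab.
  rewrite /derive_within; apply: cvg_lim => //.
  apply: (@cvg_trans _ ((v^T *m Om *m ((x - t)^-1 *: (Z x - Z t)) *m invmx (P *m Z x) *m y) 0 0
      @[x --> within D t^'])).
    apply: near_eq_cvg; apply: filterS (near_punctured fE) => x ->.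
    by rewrite ft subr0 -scalemxAr -!scalemxAl mxE mulrC.
  have -> : v^T *m Om *m Z' *m y = v^T *m Om *m Z' *m invmx (P *m Z t) *m y.
    by rewrite PZ invmx1 mulmx1.
  have cst k l (A : 'M[R]_(k, l)) : mx_cvg (within D t^') (fun=> A) A by exact: mx_cvg_cst.
  suff : mx_cvg (within D t^')
      (fun x => v^T *m Om *m ((x - t)^-1 *: (Z x - Z t)) *m invmx (P *m Z x) *m y)
    (v^T *m Om *m Z' *m invmx (P *m Z t) *m y) by apply.
  apply: mx_cvg_mul; last exact: cst.
  apply: mx_cvg_mul; first by apply: mx_cvg_mul; [exact: cst | exact: Zd].
  apply: mx_cvg_inv; last by rewrite PZ unitmx1.
  by apply: mx_cvg_mul; [exact: cst | exact: Zc].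
rewrite /velocity_form; set A := [set q | _].
have : A (get A).
  have [_ [W [f [compl gr _]]]] := Lam_smooth tab.
  by apply: getPex; exists (derive_within D (fun x => sform Om v (f x (Z t *m y))) t), W, f.
by move=> [W [f [compl gr ->]]]; exact: (key W f compl gr).
Qed.

Lemma signature_dim0 (K : {vspace 'cV[R]_(m + m)}) q : \dim K = 0%N -> signature K q = 0.
Proof.
rewrite /signature; move: (gram K q); case: (\dim K) => // M _.
by rewrite [M]flatmx0 mx_signature0.
Qed.

Variable L : {vspace 'cV[R]_(m + m)}.
Hypothesis LE : forall v, v \in L <-> be *m v = 0.

Lemma no_crossing_signature t (Z : 'M[R]_(m + m, m)) : is_frame Z (Lam t) ->
  be *m Z \in unitmx -> crossing_sign Om D Lam L t = 0.
Proof.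
move=> hZ bu; apply: signature_dim0; apply/eqP; rewrite dimv_eq0 -subv0.
apply/subvP => v; rewrite memv_cap => /andP[/(hZ.1 v).1[y ->] /LE].
rewrite mulmxA => /(congr1 (mulmx (invmx (be *m Z)))); rewrite mulKmx // mulmx0 => ->.
by rewrite mulmx0 mem0v.
Qed.

(** The columns of Z_t K are a basis of Lam_t :&: L, on which be vanishes. So of
    the derivative of the chart matrix only (al Z_t)^T (be Z') is left on K, and
    this is Om(v, Z'), the crossing form. *)
Lemma crossing_form_matrix t j : t \in `[a, b] ->
  nondegenerate_on (Lam t :&: L)%VS (velocity_form Om D Lam t) ->
  transverse al be j (Lam t) ->
  exists (Z : R -> 'M[R]_(m + m, m)) (S' : 'M[R]_m)
      (K : 'M[R]_(m, \dim (Lam t :&: L)%VS)),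
    let S x := chart_matrix al be j (Z x) in let G := K^T *m S' *m K in
    [/\ \forall x \near within D (nbhs t), is_frame (Z x) (Lam x),
        mx_cvg (within D t^') (fun x => (x - t)^-1 *: (S x - S t)) S',
        row_free K^T /\ S t *m K = 0,
        forall v : 'cV[R]_m, S t *m v = 0 -> exists y, v = K *m y &
        [/\ G^T = G, G \in unitmx & crossing_sign Om D Lam L t = mx_signature G]].
Proof.
move=> tab nondeg tj; have [Z [Z' [hZ hZt Zd]]] := smooth_frame tab.
have lagt := (Lam_smooth tab).1.
pose c x := chart_coord al be j *m Z x; pose B x := be *m Z x.
have cu : c t \in unitmx by exact/(transverseP al be j hZt).
pose S x := (c x)^T *m B x.
pose V := basis_mx (Lam t :&: L)%VS; have hV := is_frame_basis (Lam t :&: L)%VS.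
have [K VK] : exists K, V = Z t *m K.
  apply: (is_frame_factor hZt) => y; have := is_frame_mem y hV.
  by rewrite memv_cap => /andP[].
have BK : B t *m K = 0.
  rewrite -mulmxA -VK; apply/matrixP => i l.
  have -> : (be *m V) i l = (be *m col l V) i 0 by rewrite [col l V]colE mulmxA -colE [RHS]mxE.
  have /LE -> : col l V \in L.
    by have := is_frame_mem (delta_mx l 0) hV; rewrite -colE memv_cap => /andP[].
  by rewrite !mxE.
have SK : S t *m K = 0 by rewrite /S -mulmxA BK mulmx0.
have St : (S t)^T = S t := lagrangian_sym Om_darboux j lagt hZt.
have Kinj (y : 'cV_(\dim (Lam t :&: L)%VS)) : K *m y = 0 -> y = 0.
  by move=> Ky; apply: hV.2; rewrite -/V VK -mulmxA Ky mulmx0.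
have Kfree : row_free K^T.
  rewrite -kermx_eq0; apply/eqP/row_matrixP => i; rewrite row0.
  apply: trmx_inj; rewrite trmx0; apply: Kinj; apply: trmx_inj.
  by rewrite trmx_mul trmxK trmx0 -row_mul mulmx_ker row0.
have Kker (v : 'cV[R]_m) : S t *m v = 0 -> exists y, v = K *m y.
  rewrite /S -mulmxA => /(congr1 (mulmx (invmx (c t)^T))).
  rewrite mulKmx ?unitmx_tr // mulmx0 => Bv.
  have : Z t *m v \in (Lam t :&: L)%VS.
    by rewrite memv_cap is_frame_mem //=; apply/LE; rewrite mulmxA.
  move=> /(hV.1 _).1[y Zv]; exists y; apply: (is_frame_inj hZt).
  by rewrite mulmxA -VK.
pose S' := (c t)^T *m (be *m Z') + (chart_coord al be j *m Z')^T *m B t.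
have cst k l (A : 'M[R]_(k, l)) : mx_cvg (within D t^') (fun=> A) A by exact: mx_cvg_cst.
have Zc := quotient_cvg Zd.
have Sd : mx_cvg (within D t^') (fun x => (x - t)^-1 *: (S x - S t)) S'.
  apply: (@mx_cvg_eq _ _ _ _ _ _ (fun x => (c x)^T *m (be *m ((x - t)^-1 *: (Z x - Z t)))
     + (chart_coord al be j *m ((x - t)^-1 *: (Z x - Z t)))^T *m B t)).
    apply: filterE => x; rewrite -!scalemxAr [(_ *: _)^T]linearZ /= -scalemxAl -scalerDr.
    congr (_ *: _); rewrite !mulmxBr [(_ - _)^T]linearB /= mulmxBl.
    rewrite -/(c x) -/(c t) -/(B x) -/(B t).
    by rewrite addrA subrK.
  apply: mx_cvgD; apply: mx_cvg_mul => //; first by apply: mx_cvg_tr; exact: mx_cvg_mul.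
    exact: mx_cvg_mul.
  by apply: mx_cvg_tr; exact: mx_cvg_mul.
have Ssym : \forall x \near within D (nbhs t), (S x)^T = S x.
  apply: filterS2 hZ (near_within_D D t) => x hZx Dx.
  exact: (lagrangian_sym Om_darboux j (Lam_smooth Dx).1 hZx).
have PF := punctured_proper ab tab.
have S'sym : S'^T = S'.
  apply/matrixP => i l; rewrite mxE; apply: (cvg_unique _ (Sd l i)); first by [].
  apply: cvg_trans (Sd i l); apply: near_eq_cvg.
  apply: filterS (near_punctured Ssym) => x Sx.
  by rewrite -[in RHS]St -[in RHS]Sx !mxE.
pose G := K^T *m S' *m K.
have GV : G = V^T *m Om *m Z' *m K.
  rewrite /G /S' mulmxDr mulmxDl -[X in _ + X]mulmxA -(mulmxA _ (B t)) BK !mulmx0 addr0.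
  have bV : V^T *m be^T = 0.
    by rewrite -trmx_mul VK mulmxA BK trmx0.
  rewrite (darboux_shift Om_darboux j) mulmxBr !mulmxBl !(mulmxA V^T) bV !mul0mx subr0.
  by rewrite VK /c !trmx_mul !mulmxA.
have GE : gram (Lam t :&: L)%VS (velocity_form Om D Lam t) = G.
  apply/matrixP => i l; rewrite mxE.
  have vcol (p : 'I_(\dim (Lam t :&: L)%VS)) : (vbasis (Lam t :&: L)%VS)`_p = col p V.
    by apply/colP => q; rewrite !mxE.
  have -> : (vbasis (Lam t :&: L)%VS)`_l = Z t *m col l K.
    by rewrite vcol VK !colE mulmxA.
  rewrite (velocity_formE _ tab hZ Zd); last first.
    have : (vbasis (Lam t :&: L)%VS)`_i \in (Lam t :&: L)%VS.
      by apply: vbasis_mem; apply: mem_nth; rewrite size_tuple.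
    by rewrite memv_cap => /andP[].
  rewrite vcol GV -(mulmxA _ Z' K) mx_formE [col l (Z' *m K)]colE [col l K]colE.
  by rewrite !mulmxA.
have Gsym : G^T = G by exact: sym_congr.
have Gu : G \in unitmx.
  apply: unitmx_inj => x Gx; apply: hV.2; apply: nondeg; first exact: is_frame_mem.
  move=> v' /(hV.1 v').1 [z ->].
  have VL : basis_mx (Lam t :&: L)%VS *m x \in Lam t.
    by have := is_frame_mem x hV; rewrite memv_cap => /andP[].
  rewrite -/V VK -(mulmxA _ K z) (velocity_formE _ tab hZ Zd) -?VK //.
  have -> : (V *m x)^T *m Om *m Z' *m (K *m z) = (G *m x)^T *m z.
    by rewrite [(G *m x)^T]trmx_mul Gsym GV trmx_mul !mulmxA.
  by rewrite Gx trmx0 mul0mx mxE.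
exists Z, S', K; split; [exact: hZ | exact: Sd | exact: conj Kfree SK | exact: Kker |].
split; [exact: Gsym | exact: Gu |].
by rewrite /crossing_sign /signature GE.
Qed.

Lemma crossing_jump t j : t \in `[a, b] ->
  nondegenerate_on (Lam t :&: L)%VS (velocity_form Om D Lam t) ->
  transverse al be j (Lam t) ->
  \forall x \near within D (nbhs t),
    (t < x -> chart_signature al be j (Lam x)
       = chart_signature al be j (Lam t) + crossing_sign Om D Lam L t /\
      crossing_sign Om D Lam L x = 0) /\
    (x < t -> chart_signature al be j (Lam x)
       = chart_signature al be j (Lam t) - crossing_sign Om D Lam L t /\
      crossing_sign Om D Lam L x = 0).
Proof.
move=> tab nondeg tj.
have [Z [S' [K [hZ Sd [Kfree SK] Kker [Gsym Gu csE]]]]] := crossing_form_matrix tab nondeg tj.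
have hZt : is_frame (Z t) (Lam t) := @nearW_within _ D t _ tab hZ.
have lagt := (Lam_smooth tab).1.
have nD : \forall x \near within D (nbhs t), D x by exact: withinT.
have Ssym : \forall x \near within D (nbhs t),
    (chart_matrix al be j (Z x))^T = chart_matrix al be j (Z x).
  apply: filterS2 hZ nD => x hZx Dx.
  exact: (lagrangian_sym Om_darboux j (Lam_smooth Dx).1 hZx).
have jump := mx_signature_jump tab Ssym Sd Kfree SK Kker Gsym Gu.
rewrite csE (chart_signatureE Om_darboux j lagt hZt).
apply: filterS3 hZ nD jump => x hZx Dx [right left].
have lagx := (Lam_smooth Dx).1.
rewrite (chart_signatureE Om_darboux j lagx hZx).
have no_crossing : chart_matrix al be j (Z x) \in unitmx -> crossing_sign Om D Lam L x = 0.
  by rewrite unitmx_mul => /andP[_]; exact: (no_crossing_signature hZx).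
by split=> [/right|/left] [-> u]; (split; last exact: no_crossing).
Qed.

End SmoothPaths.

(** * The index of a path in a single chart *)

(** Here p, q and nu are the values of S0, S1 and the identity on a kernel vector
    of the path S0 + t (S1 - S0) + c t (1 - t), and the last hypothesis says that
    the derivative of the path vanishes on it. With c = 8 B + 1 it forces
    |1 - 2 t| <= 1/4, where the bulge c t (1 - t) exceeds B. *)
Lemma bulge_arith (R : realFieldType) (B nu p q t : R) : 0 <= B -> 0 < nu ->
  0 <= t -> t <= 1 -> `|p| <= B * nu -> `|q| <= B * nu ->
  p + t * (q - p) + (8 * B + 1) * (t * (1 - t)) * nu = 0 ->
  q - p + (8 * B + 1) * (1 - 2 * t) * nu = 0 -> False.
Proof.
move=> B0 nu0 t0 t1; rewrite !ler_norml => /andP[p1 p2] /andP[q1 q2] e1 e2.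
set c := 8 * B + 1 in e1 e2.
pose r := 1 - 2 * t; have tE : t = (1 - r) / 2 by rewrite /r; field.
have cnu : 0 < c * nu by rewrite mulr_gt0 // /c; lra.
have h1 : (c * nu) * r <= (c * nu) / 4 by rewrite /c in e2 *; rewrite -/r in e2; nra.
have h2 : - ((c * nu) / 4) <= (c * nu) * r by rewrite /c in e2 *; rewrite -/r in e2; nra.
have r1 : r <= 1 / 4 by rewrite -(ler_pM2l cnu); lra.
have r2 : - (1 / 4) <= r by rewrite -(ler_pM2l cnu); lra.
have w : 15 / 64 <= t * (1 - t) by rewrite tE; nra.
have h3 : 15 / 64 * (c * nu) <= t * (1 - t) * (c * nu) by rewrite ler_pM2r.
have h4 : - (B * nu) <= p + t * (q - p) by nra.
have h5 : 15 / 64 * (c * nu) <= B * nu by move: e1; rewrite mulrAC; lra.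
rewrite /c in h5; nra.
Qed.

Section GraphPaths.
Context {R : realType} {m : nat}.
Variables (Om : 'M[R]_(m + m)) (al be : 'M[R]_(m, m + m)).
Hypothesis Om_darboux : darboux Om al be.

(** The Lagrangian subspaces transverse to W_0 = ker al are the graphs of the
    symmetric matrices. *)
Definition graph_space (S : 'M[R]_m) : {vspace 'cV[R]_(m + m)} :=
  lker (linfun (mulmx (be - S *m al))).

(** Bases of ker be and of ker al dual to the coordinates al and be. *)
Definition base_mx : 'M[R]_(m + m, m) := lsubmx (invmx (col_mx al be)).
Definition complement_mx : 'M[R]_(m + m, m) := rsubmx (invmx (col_mx al be)).
Local Notation Lmx := base_mx.
Local Notation Wmx := complement_mx.

Lemma dual_basis : [/\ al *m Lmx = 1%:M, al *m Wmx = 0, be *m Lmx = 0 & be *m Wmx = 1%:M].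
Proof.
have := mulmxV Om_darboux.2; rewrite -{1}[invmx _]hsubmxK mul_col_row scalar_mx_block.
by move=> /eq_block_mx[].
Qed.

Lemma dual_basisE (v : 'cV[R]_(m + m)) : v = Lmx *m (al *m v) + Wmx *m (be *m v).
Proof.
by rewrite -mul_row_col hsubmxK -mul_col_mx mulKmx // Om_darboux.2.
Qed.

Lemma mem_graph_space S v : v \in graph_space S <-> be *m v = S *m (al *m v).
Proof.
rewrite memv_ker lfunE /= mulmxBl -mulmxA subr_eq0.
by split=> [/eqP|->].
Qed.

Definition graph_frame (S : 'M[R]_m) := Lmx + Wmx *m S.

Lemma al_graph_frame S : al *m graph_frame S = 1%:M.
Proof.
have [aX aY _ _] := dual_basis.
by rewrite mulmxDr aX mulmxA aY mul0mx addr0.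
Qed.

Lemma be_graph_frame S : be *m graph_frame S = S.
Proof.
have [_ _ bX bY] := dual_basis.
by rewrite mulmxDr bX mulmxA bY mul1mx add0r.
Qed.

Lemma is_frame_graph S : is_frame (graph_frame S) (graph_space S).
Proof.
split=> [v|y]; last first.
  by move=> /(congr1 (mulmx al)); rewrite mulmxA al_graph_frame mul1mx mulmx0.
split=> [/mem_graph_space h|[y ->]].
  exists (al *m v); rewrite mulmxDl -mulmxA -h; exact: dual_basisE.
by apply/mem_graph_space; rewrite !mulmxA be_graph_frame -(mulmxA S) al_graph_frame mulmx1.
Qed.

Lemma graph_lagrangian S : S^T = S -> lagrangian Om (graph_space S).
Proof.
move=> Ssym; split; last by rewrite (is_frame_dim (is_frame_graph S)) addnn.
move=> u v /mem_graph_space bu /mem_graph_space bv.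
rewrite /sform Om_darboux.1 mulmxBr mulmxBl.
have -> : u^T *m (al^T *m be) *m v = (al *m u)^T *m S *m (al *m v).
  by rewrite -!mulmxA bv trmx_mul !mulmxA.
have -> : u^T *m (be^T *m al) *m v = (al *m u)^T *m S *m (al *m v).
  by rewrite (mulmxA u^T) -trmx_mul bu trmx_mul Ssym !mulmxA.
by rewrite subrr mxE.
Qed.

Definition complement_space : {vspace 'cV[R]_(m + m)} := lker (linfun (mulmx al)).

Lemma mem_complement_space v : v \in complement_space <-> al *m v = 0.
Proof. by rewrite memv_ker lfunE /=; split=> [/eqP|->]. Qed.

Lemma is_frame_complement : is_frame Wmx complement_space.
Proof.
have [_ aY _ bY] := dual_basis.
split=> [v|y]; last first.
  by move=> /(congr1 (mulmx be)); rewrite mulmxA bY mul1mx mulmx0.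
split=> [/mem_complement_space av|[y ->]].
  by exists (be *m v); rewrite {1}[v]dual_basisE av mulmx0 add0r.
by apply/mem_complement_space; rewrite mulmxA aY mul0mx.
Qed.

Lemma graph_complement S : lagrangian_complement Om (graph_space S) complement_space.
Proof.
have [aX aY bX bY] := dual_basis.
split.
- split; last by rewrite (is_frame_dim is_frame_complement) addnn.
  move=> u v /mem_complement_space au /mem_complement_space av.
  rewrite /sform Om_darboux.1 mulmxBr mulmxBl.
  by rewrite (mulmxA u^T) -trmx_mul au trmx0 !mul0mx -!mulmxA av !mulmx0 subrr mxE.
- apply/eqP; rewrite eqEsubv subvf /=; apply/subvP => v _.
  have -> : v = graph_frame S *m (al *m v) + Wmx *m (be *m v - S *m (al *m v)).
    rewrite {1}[v]dual_basisE mulmxDl mulmxBr -!mulmxA -addrA.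
    by congr (_ + _); rewrite addrC subrK.
  apply: memv_add; first exact: is_frame_mem (is_frame_graph S).
  exact: is_frame_mem is_frame_complement.
apply/eqP; rewrite -subv0; apply/subvP => v; rewrite memv_cap memv0.
move=> /andP[/mem_graph_space bv /mem_complement_space av].
by rewrite [v]dual_basisE bv av !mulmx0 addr0.
Qed.

Definition graph_chart_map (S0 S : 'M[R]_m) : 'End('cV[R]_(m + m)) :=
  linfun (mulmx (Wmx *m (S - S0) *m al)).

Lemma graph_chart_mapP (T : topologicalType) (D : set T) (S : T -> 'M[R]_m)
    (F : T -> {vspace 'cV[R]_(m + m)}) x0 : D x0 ->
  (forall x, D x -> F x = graph_space (S x)) ->
  graph_chart D F x0 complement_space (fun x => graph_chart_map (S x0) (S x)).
Proof.
move=> Dx0 FE; have [aX aY bX bY] := dual_basis.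
apply: filterS (near_within_D D x0) => x Dx; rewrite !FE //.
have fE v : graph_chart_map (S x0) (S x) v = Wmx *m ((S x - S x0) *m (al *m v)).
  by rewrite lfunE /= !mulmxA.
split.
  apply/subvP => w /memv_imgP[u _ ->]; rewrite fE.
  exact: is_frame_mem is_frame_complement.
apply/vspaceP => v; apply/idP/idP.
  move=> /mem_graph_space bv.
  pose u := v - graph_chart_map (S x0) (S x) v.
  have au : al *m u = al *m v by rewrite mulmxBr fE (mulmxA al) aY mul0mx subr0.
  have -> : v = (\1 + graph_chart_map (S x0) (S x))%VF u.
    by rewrite add_lfunE id_lfunE fE au -fE subrK.
  apply: memv_img; apply/mem_graph_space.
  by rewrite au mulmxBr bv fE (mulmxA be) bY mul1mx mulmxBl subKr.
move=> /memv_imgP[u /mem_graph_space bu ->]; apply/mem_graph_space.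
rewrite add_lfunE id_lfunE fE 2!mulmxDr (mulmxA al) aY mul0mx addr0.
by rewrite (mulmxA be) bY mul1mx mulmxBl bu addrC subrK.
Qed.

Lemma cvg_mx_entries (T : Type) (F : set_system T) (FF : Filter F) p q
    (A : T -> 'M[R]_(p, q)) (A0 : 'M[R]_(p, q)) : mx_cvg F A A0 -> A x @[x --> F] --> A0.
Proof.
move=> h; apply/cvgrPdist_lt => e e0.
have : \forall x \near F, forall ij : 'I_p * 'I_q, `|A0 ij.1 ij.2 - A x ij.1 ij.2| < e.
  apply: filter_forall => -[i j] /=.
  by have /cvgrPdist_lt /(_ _ e0) := h i j.
apply: filterS => x hx; rewrite /Num.Def.normr/= mx_normrE.
by apply: bigmax_lt => // -[i j] _; rewrite !mxE; exact: (hx (i, j)).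
Qed.

Lemma graph_continuous (T : topologicalType) (D : set T) (S : T -> 'M[R]_m)
    (F : T -> {vspace 'cV[R]_(m + m)}) :
  (forall x, D x -> F x = graph_space (S x)) ->
  (forall x, D x -> (S x)^T = S x) ->
  (forall x, D x -> mx_cvg (within D (nbhs x)) S (S x)) ->
  lagrangian_continuous Om D F.
Proof.
move=> FE Ssym Sc x0 Dx0; split; first by rewrite FE //; exact/graph_lagrangian/Ssym.
exists complement_space, (fun x => graph_chart_map (S x0) (S x)); split.
- by rewrite FE //; exact: graph_complement.
- exact: graph_chart_mapP.
move=> v _; apply: cvg_mx_entries; rewrite lfunE /=.
under eq_fun do rewrite lfunE /=.
apply: mx_cvg_mul; last exact: mx_cvg_cst.
apply: mx_cvg_mul; last exact: mx_cvg_cst.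
apply: mx_cvg_mul; first exact: mx_cvg_cst.
by apply: mx_cvgD; [exact: Sc | exact: mx_cvg_cst].
Qed.

Lemma smooth_poly p q (P : 'I_p -> 'I_q -> {poly R}) :
  smooth (fun t : R => (\matrix_(i, j) (P i j).[t] : 'M[R]_(p, q))).
Proof.
have d (P' : 'I_p -> 'I_q -> {poly R}) t :
    derivable (fun t : R => (\matrix_(i, j) (P' i j).[t] : 'M[R]_(p, q))) t 1.
  apply/derivable_mxP => i j; under eq_fun do rewrite mxE.
  exact: derivable_horner.
move=> k; elim: k P => [|k IHk] P t; first exact: d.
rewrite derive1Sn.
have -> : (fun t : R => (\matrix_(i, j) (P i j).[t] : 'M[R]_(p, q)))^`()%classic
    = (fun t : R => \matrix_(i, j) ((P i j)^`()).[t]).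
  apply/funext => u; rewrite derive1E derive_mx //; apply/matrixP => i j.
  rewrite !mxE derivE derive1E; congr ('D_1 _ u).
  by apply/funext => w; rewrite mxE.
exact: IHk.
Qed.

(** For large c the crossings of this path from S0 to S1 lie near the ends, where
    its derivative is definite. *)
Definition bulge_path (S0 S1 : 'M[R]_m) (c t : R) : 'M[R]_m :=
  S0 + t *: (S1 - S0) + (c * (t * (1 - t)))%:M.

Lemma bulge_path0 S0 S1 c : bulge_path S0 S1 c 0 = S0.
Proof. by rewrite /bulge_path scale0r mul0r mulr0 raddf0 !addr0. Qed.

Lemma bulge_path1 S0 S1 c : bulge_path S0 S1 c 1 = S1.
Proof.
by rewrite /bulge_path scale1r subrr !mulr0 raddf0 addr0 addrC subrK.
Qed.

Lemma bulge_path_sym S0 S1 c t : S0^T = S0 -> S1^T = S1 ->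
  (bulge_path S0 S1 c t)^T = bulge_path S0 S1 c t.
Proof.
move=> S0sym S1sym.
have s0 i j : S0 j i = S0 i j by rewrite -{1}S0sym mxE.
have s1 i j : S1 j i = S1 i j by rewrite -{1}S1sym mxE.
by apply/matrixP => i j; rewrite !mxE s0 s1 eq_sym.
Qed.

Lemma bulge_path_cvg (F : set_system R) (FF : Filter F) S0 S1 c t :
  F --> t -> mx_cvg F (bulge_path S0 S1 c) (bulge_path S0 S1 c t).
Proof.
move=> Ft; rewrite /bulge_path; apply: mx_cvgD.
  by apply: mx_cvgD; [exact: mx_cvg_cst | apply: mx_cvgZ => //; exact: mx_cvg_cst].
rewrite -scalemx1; apply: (@mx_cvg_eq _ _ _ _ _ _ (fun x => (c * (x * (1 - x))) *: 1%:M)).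
  by apply: filterE => x; rewrite scalemx1.
apply: mx_cvgZ; last exact: mx_cvg_cst.
apply: cvgM; first exact: cvg_cst.
by apply: cvgM => //; apply: cvgB => //; exact: cvg_cst.
Qed.

Lemma graph_smooth (S0 S1 : 'M[R]_m) c (D : set R) : S0^T = S0 -> S1^T = S1 ->
  lagrangian_smooth Om D (fun t => graph_space (bulge_path S0 S1 c t)).
Proof.
move=> S0sym S1sym t0 Dt0.
have Ssym t : (bulge_path S0 S1 c t)^T = bulge_path S0 S1 c t by exact: bulge_path_sym.
split; first exact: graph_lagrangian.
exists complement_space,
  (fun t => graph_chart_map (bulge_path S0 S1 c t0) (bulge_path S0 S1 c t)).
split; [exact: graph_complement | exact: graph_chart_mapP |].
move=> v _; pose f t := graph_chart_map (bulge_path S0 S1 c t0) (bulge_path S0 S1 c t) v.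
pose A := Wmx *m (S1 - S0) *m (al *m v); pose C := c *: (Wmx *m (al *m v)).
pose E := Wmx *m (S0 - bulge_path S0 S1 c t0) *m (al *m v).
exists (fun t => \matrix_(i, j)
  ((E i j)%:P + (A i j)%:P * 'X + (C i j)%:P * ('X * (1 - 'X))).[t]).
  exact: smooth_poly.
apply: filterE => t; rewrite lfunE /=.
have -> : Wmx *m (bulge_path S0 S1 c t - bulge_path S0 S1 c t0) *m al *m v
    = E + t *: A + (t * (1 - t)) *: C.
  rewrite /E /A /C -(mulmxA _ al v); set w := al *m v.
  have -> : bulge_path S0 S1 c t - bulge_path S0 S1 c t0
      = S0 - bulge_path S0 S1 c t0 + t *: (S1 - S0) + (c * (t * (1 - t)))%:M.
    by rewrite {1}/bulge_path addrAC (addrAC S0).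
  rewrite 2!mulmxDr 2!mulmxDl; congr (_ + _ + _); first by rewrite -scalemxAr -scalemxAl.
  by rewrite mul_mx_scalar -scalemxAl scalerA mulrC.
clearbody E A C; clear; apply/matrixP => i j; rewrite !mxE.
by rewrite !(hornerD, hornerN, hornerM, hornerC, hornerX); ring.
Qed.

Variable L : {vspace 'cV[R]_(m + m)}.
Hypothesis LE : forall v, v \in L <-> be *m v = 0.

Lemma bulge_regular (S0 S1 : 'M[R]_m) : S0^T = S0 -> S1^T = S1 ->
  exists c, forall t, t \in `[0, 1] ->
    nondegenerate_on (graph_space (bulge_path S0 S1 c t) :&: L)%VS
      (velocity_form Om `[0, 1]%classic (fun t => graph_space (bulge_path S0 S1 c t)) t).
Proof.
move=> S0sym S1sym.
pose M : R := \sum_i \sum_j (`|S0 i j| + `|S1 i j|).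
have M0 : 0 <= M by apply: sumr_ge0 => i _; apply: sumr_ge0 => j _; rewrite addr_ge0.
have bound i j : `|S0 i j| <= M /\ `|S1 i j| <= M.
  have : `|S0 i j| + `|S1 i j| <= M.
    rewrite /M (bigD1 i) //= (bigD1 j) //= -addrA lerDl addr_ge0 //.
      by apply: sumr_ge0 => l _; rewrite addr_ge0.
    by apply: sumr_ge0 => k _; apply: sumr_ge0 => l _; rewrite addr_ge0.
  have := normr_ge0 (S0 i j); have := normr_ge0 (S1 i j).
  by move=> h1 h2 h3; split; lra.
pose B := M * m%:R; have B0 : 0 <= B by rewrite mulr_ge0.
pose c := 8 * B + 1; exists c => t t01.
set Lam := fun t => graph_space _.
have sm : lagrangian_smooth Om `[0, 1]%classic Lam by exact: graph_smooth.
pose Z t := graph_frame (bulge_path S0 S1 c t).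
pose Z' := Wmx *m (S1 - S0 + (c * (1 - 2 * t))%:M).
have Zd : mx_cvg (within `[0, 1]%classic t^') (fun x => (x - t)^-1 *: (Z x - Z t)) Z'.
  apply: (@mx_cvg_eq _ _ _ _ _ _ (fun x => Wmx *m (S1 - S0 + (c * (1 - x - t))%:M))).
    apply/near_punctured_within; exists 1 => // x _ _ xt.
    have -> : Z x - Z t = Wmx *m (bulge_path S0 S1 c x - bulge_path S0 S1 c t).
      by rewrite /Z /graph_frame mulmxBr opprD addrACA subrr add0r.
    have -> : bulge_path S0 S1 c x - bulge_path S0 S1 c t
        = (x - t) *: (S1 - S0 + (c * (1 - x - t))%:M).
      by apply/matrixP => i j; rewrite !mxE; case: (i == j); rewrite ?mulr1n ?mulr0n; ring.
    by rewrite -scalemxAr scalerA mulVf ?subr_eq0 // scale1r.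
  apply: mx_cvg_mul; first exact: mx_cvg_cst.
  apply: mx_cvgD; first exact: mx_cvg_cst.
  move=> i j; rewrite mxE; under eq_fun do rewrite mxE.
  case: (i == j); last by under eq_fun do rewrite mulr0n; rewrite mulr0n; exact: cvg_cst.
  under eq_fun do rewrite mulr1n; rewrite mulr1n.
  have -> : 1 - 2 * t = 1 - t - (0 + t) by ring.
  apply: (@cvg_trans _ (c * (1 - t - ((x - t) + t)) @[x --> within `[0, 1]%classic t^'])).
    by apply: near_eq_cvg; apply: filterE => x /=; congr (_ * _); ring.
  apply: cvgM; first exact: cvg_cst.
  apply: cvgB; first exact: cvg_cst.
  by apply: cvgD; [exact: punctured_cvg | exact: cvg_cst].
have hZ : \forall x \near within `[0, 1]%classic (nbhs t), is_frame (Z x) (Lam x).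
  by apply: filterE => x; exact: is_frame_graph.
move=> v vL h; move: (vL); rewrite memv_cap => /andP[vLam /LE bv].
pose u := al *m v.
have vE : v = Z t *m u.
  have [y vE] := ((is_frame_graph (bulge_path S0 S1 c t)).1 v).1 vLam.
  have -> : u = y by rewrite /u vE mulmxA al_graph_frame mul1mx.
  exact: vE.
have Su : bulge_path S0 S1 c t *m u = 0.
  by move: bv; rewrite vE (mulmxA be) be_graph_frame.
have := h v vL; rewrite {2}vE (velocity_formE ltr01 sm _ t01 hZ Zd vLam).
have -> : v^T *m Om *m Z' *m u = u^T *m (S1 - S0 + (c * (1 - 2 * t))%:M) *m u.
  have [_ aY _ bY] := dual_basis.
  have -> : v^T *m Om *m Z' = u^T *m (S1 - S0 + (c * (1 - 2 * t))%:M).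
    have vO : v^T *m Om *m Wmx = u^T.
      rewrite Om_darboux.1 mulmxBr mulmxBl -(mulmxA v^T) -(mulmxA al^T) bY mulmx1.
      by rewrite -(mulmxA v^T) -(mulmxA be^T) aY !mulmx0 subr0 -trmx_mul.
    by rewrite /Z' mulmxA vO.
  by [].
move=> velo; apply/eqP; rewrite -[v == 0]negbK; apply/negP => v0.
have u0 : u != 0 by apply: contra_neq v0 => u0; rewrite vE u0 mulmx0.
pose nu := (u^T *m u) 0 0; have nu0 : 0 < nu by rewrite sqr_cV_gt0.
pose p := (u^T *m S0 *m u) 0 0; pose q := (u^T *m S1 *m u) 0 0.
have hp : `|p| <= B * nu by apply: quad_bound => i j; case: (bound i j).
have hq : `|q| <= B * nu by apply: quad_bound => i j; case: (bound i j).
have entryD (A A' : 'M[R]_1) : (A + A') 0 0 = A 0 0 + A' 0 0 by rewrite mxE.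
have entryB (A A' : 'M[R]_1) : (A - A') 0 0 = A 0 0 - A' 0 0 by rewrite !mxE.
have entryZ (r : R) (A : 'M[R]_1) : (r *: A) 0 0 = r * A 0 0 by rewrite mxE.
have e1 : p + t * (q - p) + c * (t * (1 - t)) * nu = 0.
  have : (u^T *m (bulge_path S0 S1 c t *m u)) 0 0 = 0 by rewrite Su mulmx0 mxE.
  rewrite mulmxA /bulge_path 2!mulmxDr 2!mulmxDl -scalemxAr -scalemxAl mulmxBr mulmxBl.
  by rewrite mul_mx_scalar -scalemxAl !entryD !entryZ entryB.
have e2 : q - p + c * (1 - 2 * t) * nu = 0.
  move: velo; rewrite mulmxDr mulmxDl mulmxBr mulmxBl mul_mx_scalar -scalemxAl.
  by rewrite entryD entryZ entryB.
move: t01; rewrite in_itv /= => /andP[t0 t1].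
exact: (bulge_arith B0 nu0 t0 t1 hp hq e1 e2).
Qed.

Lemma chart_signature_graph S : S^T = S ->
  chart_signature al be 0 (graph_space S) = mx_signature S.
Proof.
move=> Ssym.
rewrite (chart_signatureE Om_darboux 0 (graph_lagrangian Ssym) (is_frame_graph S)).
by rewrite /chart_matrix /chart_coord scale0r subr0 al_graph_frame be_graph_frame trmx1 mul1mx.
Qed.

Lemma transverse_graph S : transverse al be 0 (graph_space S).
Proof.
apply/(transverseP al be 0 (is_frame_graph S)).
by rewrite /chart_coord scale0r subr0 al_graph_frame unitmx1.
Qed.

(** The homotopy starts in the chart W_0, where the signature itself is an index
    function. By homotopy invariance the index function of the smooth path has
    the same increment, and this is twice the crossing sum. *)
Lemma rs_index_value (S : R -> 'M[R]_m) (Lam Lam' : R -> {vspace 'cV[R]_(m + m)}) :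
  (forall t : R, t \in `[0, 1] -> (S t)^T = S t) ->
  (forall t : R, t \in `[0, 1] -> Lam t = graph_space (S t)) ->
  lagrangian_smooth Om `[0, 1]%classic Lam' ->
  (forall t : R, t \in `[0, 1] -> crossing Lam' L t ->
     regular_crossing Om `[0, 1]%classic Lam' L t) ->
  homotopic_rel_endpoints Om 0 1 Lam Lam' ->
  crossing_sum Om 0 1 Lam' L = (mx_signature (S 1) - mx_signature (S 0))%:Q / 2.
Proof.
move=> Ssym LamE sm reg [H [Hc H0 H1 Hend]].
have cs := lagrangian_chart_system Om_darboux Hc.
have z01 : (0 : R) \in `[0, 1] by rewrite in_itv /= lexx ler01.
have i01 : (1 : R) \in `[0, 1] by rewrite in_itv /= lexx ler01.
have row0 := chart_system_row cs z01; have row1 := chart_system_row cs i01.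
pose f0 t := chart_signature al be 0 (H (0, t)).
have hf0 : index_function (`[0, 1]%classic : set R) (fun j t => transverse al be j (H (0, t)))
    (fun j t => chart_signature al be j (H (0, t))) f0.
  apply: (index_functionI row0) => t tab; exists 0%N.
    by rewrite H0 // LamE //; exact: transverse_graph.
  by apply: filterE => u; rewrite /f0 !subrr.
have [f1 _ hf1] := index_function_exists 0 (@ler01 R) row1.
have f0E t : t \in `[0, 1] -> f0 t = mx_signature (S t).
  move=> t01; rewrite /f0 H0 // LamE // chart_signature_graph //; exact: Ssym.
have f01 : f1 1 - f1 0 = mx_signature (S 1) - mx_signature (S 0).
  rewrite -!f0E //; apply: (index_homotopy _ cs) => // j s s01.
    by rewrite (Hend s s01).1 (Hend 0 z01).1.
  by rewrite (Hend s s01).2 (Hend 0 z01).2.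
rewrite -f01 /crossing_sum; apply: (@crossing_count R 0 1 f1) => //.
  move=> t t01 g0 nocross; move/eqP: g0; apply; apply: signature_dim0.
  by rewrite nocross dimv0.
move=> t t01; have lagt := (sm t t01).1.
have [j tj] := transverse_exists Om_darboux lagt.
have nondeg : nondegenerate_on (Lam' t :&: L)%VS (velocity_form Om `[0, 1]%classic Lam' t).
  have [cr|ncr] := pselect (crossing Lam' L t); first exact: (reg t t01 cr).2.
  by move=> v; rewrite (contrapT ncr) memv0 => /eqP.
have jump := crossing_jump Om_darboux ltr01 sm LE t01 nondeg tj.
have tj1 : transverse al be j (H (1, t)) by rewrite H1.
have ind := hf1 t j t01 tj1.
have nD : \forall u \near within `[0, 1]%classic (nbhs t), u \in `[0, 1].
  exact: withinT.
apply: filterS3 jump ind nD => u [up down] ind1 u01.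
move: ind1; rewrite !H1 // => ind1.
split=> lt.
  have [e g0] := up lt; split=> //; move: ind1; rewrite e; clear.
  move: (f1 u) (f1 t) (chart_signature _ _ _ _) (crossing_sign _ _ _ _ t) => *; lia.
have [e g0] := down lt; split=> //; move: ind1; rewrite e; clear.
move: (f1 u) (f1 t) (chart_signature _ _ _ _) (crossing_sign _ _ _ _ t) => *; lia.
Qed.

Lemma mx_cvg_comp (T U : Type) (F : set_system T) (G : set_system U) p q
    (phi : T -> U) (A : U -> 'M[R]_(p, q)) A0 :
  phi @ F --> G -> mx_cvg G A A0 -> mx_cvg F (fun x => A (phi x)) A0.
Proof. by move=> phiG hA i j; exact: cvg_comp phiG (hA i j). Qed.

(** All regular smooth paths in the homotopy class give the same value, and the
    bulge path is one of them: it is joined to the given path by a linear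
    homotopy of matrices. *)
Theorem rs_index_graph (S : R -> 'M[R]_m) (Lam : R -> {vspace 'cV[R]_(m + m)}) :
  (forall t : R, t \in `[0, 1] -> (S t)^T = S t) ->
  (forall t : R, t \in `[0, 1] -> mx_cvg (within `[0, 1]%classic (nbhs t)) S (S t)) ->
  (forall t : R, t \in `[0, 1] -> Lam t = graph_space (S t)) ->
  rs_index Om 0 1 Lam L = (mx_signature (S 1) - mx_signature (S 0))%:Q / 2.
Proof.
move=> Ssym Sc LamE; apply: xget_subset1; last first.
  move=> k l [Lk [smk regk homk ->]] [Ll [sml regl homl ->]].
  by rewrite (rs_index_value Ssym LamE smk regk homk) (rs_index_value Ssym LamE sml regl homl).
have z01 : (0 : R) \in `[0, 1] by rewrite in_itv /= lexx ler01.
have i01 : (1 : R) \in `[0, 1] by rewrite in_itv /= lexx ler01.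
have S0sym := Ssym 0 z01; have S1sym := Ssym 1 i01.
have [c nondeg] := bulge_regular S0sym S1sym.
pose P t := bulge_path (S 0) (S 1) c t.
have sm : lagrangian_smooth Om `[0, 1]%classic (fun t => graph_space (P t)).
  exact: graph_smooth.
have reg t : t \in `[0, 1] -> crossing (fun t => graph_space (P t)) L t ->
    regular_crossing Om `[0, 1]%classic (fun t => graph_space (P t)) L t.
  by move=> t01 cr; split=> //; exact: nondeg.
have Psym t : (P t)^T = P t by exact: bulge_path_sym.
have hom : homotopic_rel_endpoints Om 0 1 Lam (fun t => graph_space (P t)).
  pose Q (x : R * R) := (1 - x.1) *: S x.2 + x.1 *: P x.2.
  exists (fun x => graph_space (Q x)); split.
  - apply: (graph_continuous (S := Q)) => // -[s t] /= [s01 t01].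
      by rewrite /Q /= [LHS]linearD /= 2!linearZ /= Ssym // Psym.
    have c1 : (fun x : R * R => x.1)
        @ within ([set` `[0, 1]] `*` [set` `[0, 1]]) (nbhs (s, t)) --> s.
      by apply: cvg_within_filter; exact: cvg_fst.
    have c2 : (fun x : R * R => x.2) @ within ([set` `[0, 1]] `*` [set` `[0, 1]]) (nbhs (s, t))
        --> within `[0, 1]%classic (nbhs t).
      move=> V /near_withinP[e e0 he]; apply/nbhs_ballP.
      by exists e => // -[s' t'] [_ tt] [_ t'01]; exact: he.
    apply: mx_cvgD; apply: mx_cvgZ.
    - by apply: cvgB => //; exact: cvg_cst.
    - by apply: (mx_cvg_comp c2); exact: Sc.
    - exact: c1.
    - by apply: (mx_cvg_comp c2); apply: bulge_path_cvg; exact: cvg_within.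
  - by move=> t t01; rewrite /Q /= subr0 scale1r scale0r addr0 LamE.
  - by move=> t t01; rewrite /Q /= subrr scale1r scale0r add0r.
  - move=> s s01; rewrite /Q /= /P bulge_path0 bulge_path1 !LamE //.
    by rewrite -!scalerDl subrK !scale1r.
exists (fun t => graph_space (P t)); split=> //.
by rewrite (rs_index_value Ssym LamE sm reg hom).
Qed.

End GraphPaths.

(** * Shears *)

Section Shears.
Context {R : realType} {n : nat}.

Definition vertical_al : 'M[R]_(n, n + n) := row_mx 0 (- 1%:M).
Definition vertical_be : 'M[R]_(n, n + n) := row_mx 1%:M 0.

Lemma tr_Omega0 : (Omega0 : 'M[R]_(n + n))^T = - Omega0.
Proof.
rewrite /Omega0 tr_block_mx !trmx0 [(- 1%:M)^T]linearN /= trmx1.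
by rewrite opp_block_mx !oppr0 opprK.
Qed.

Lemma Omega0_unit : (Omega0 : 'M[R]_(n + n)) \in unitmx.
Proof.
have [//] : (Omega0 : 'M[R]_(n + n)) \in unitmx /\ (Omega0 : 'M[R]_(n + n))^T \in unitmx.
apply: mulmx1_unit; rewrite tr_Omega0 mulmxN /Omega0 mulmx_block.
rewrite !(mulmx0, mul0mx, addr0, add0r, mulmx1, mul1mx) opp_block_mx !oppr0 opprK.
by rewrite -scalar_mx_block.
Qed.

Lemma darboux_vertical : darboux Omega0 vertical_al vertical_be.
Proof.
split.
  rewrite /vertical_al /vertical_be !tr_row_mx !mul_col_row !trmx0 trmx1.
  rewrite [(- 1%:M)^T]linearN /= trmx1.
  rewrite !(mulmx0, mul0mx, mulmx1, mul1mx) opp_block_mx add_block_mx.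
  by rewrite !(oppr0, addr0, add0r, opprK).
apply: unitmx_inj => x; rewrite mul_col_mx /vertical_al /vertical_be -[x]vsubmxK !mul_row_col.
rewrite !mul0mx mulNmx !mul1mx add0r addr0 => /eqP.
by rewrite col_mx_eq0 oppr_eq0 => /andP[/eqP -> /eqP ->]; rewrite col_mx0.
Qed.

Lemma mem_vertical (v : 'cV[R]_(n + n)) : v \in vertical <-> vertical_be *m v = 0.
Proof.
have -> : vertical_be *m v = usubmx v.
  by rewrite /vertical_be -{1}[v]vsubmxK mul_row_col mul1mx mul0mx addr0.
rewrite memv_ker lfunE /=.
by split=> [/eqP|->].
Qed.

Lemma shearE (B : 'M[R]_n) (x y : 'cV[R]_n) :
  shear B *m col_mx x y = col_mx (x + B *m y) y.
Proof. by rewrite /shear mul_block_col !mul1mx mul0mx add0r. Qed.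

Lemma shear_vertical (B : 'M[R]_n) :
  (linfun (fun x : 'cV[R]_(n + n) => shear B *m x) @: vertical)%VS
    = graph_space vertical_al vertical_be (- B).
Proof.
have alE (v : 'cV[R]_(n + n)) : vertical_al *m v = - dsubmx v.
  by rewrite /vertical_al -{1}[v]vsubmxK mul_row_col mulNmx mul1mx mul0mx add0r.
have beE (v : 'cV[R]_(n + n)) : vertical_be *m v = usubmx v.
  by rewrite /vertical_be -{1}[v]vsubmxK mul_row_col mul1mx mul0mx addr0.
apply/vspaceP => v; apply/idP/idP => [/memv_imgP[u /mem_vertical + ->]|/mem_graph_space].
  rewrite beE lfunE /= => u0; apply/mem_graph_space.
  rewrite alE beE -[u]vsubmxK u0 shearE add0r col_mxKu col_mxKd.
  by rewrite mulmxN mulNmx opprK.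
rewrite alE beE mulmxN mulNmx opprK => vE.
apply/memv_imgP; exists (col_mx 0 (dsubmx v)).
  by apply/mem_vertical; rewrite beE col_mxKu.
by rewrite lfunE /= shearE add0r -vE vsubmxK.
Qed.

(** ker diagonal_al is the graph of -Id, a Lagrangian complement of the diagonal.
    It meets the graph of no shear, since -1 is not an eigenvalue of a shear. *)
Definition diagonal_al : 'M[R]_(n + n, (n + n) + (n + n)) :=
  row_mx (2^-1 *: Omega0^T) (2^-1 *: Omega0^T).
Definition diagonal_be : 'M[R]_(n + n, (n + n) + (n + n)) := row_mx (- 1%:M) 1%:M.

Lemma diagonal_alE (v : 'cV[R]_((n + n) + (n + n))) :
  diagonal_al *m v = 2^-1 *: (Omega0^T *m (usubmx v + dsubmx v)).
Proof. by rewrite /diagonal_al -{1}[v]vsubmxK mul_row_col -!scalemxAl -scalerDr -mulmxDr. Qed.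

Lemma diagonal_beE (v : 'cV[R]_((n + n) + (n + n))) : diagonal_be *m v = dsubmx v - usubmx v.
Proof. by rewrite /diagonal_be -{1}[v]vsubmxK mul_row_col mulNmx !mul1mx addrC. Qed.

Lemma darboux_diagonal : darboux Omega_bar diagonal_al diagonal_be.
Proof.
have two : (2 : R) != 0 by rewrite pnatr_eq0.
split.
  rewrite /diagonal_al /diagonal_be !tr_row_mx !mul_col_row [(- 1%:M)^T]linearN /= trmx1.
  rewrite [(_ *: _)^T]linearZ /= trmxK tr_Omega0 !mulmxN !mulNmx !mulmx1 !mul1mx.
  rewrite !scalerN !opprK opp_block_mx add_block_mx !opprK subrr addNr -opprD -scalerDl.
  have -> : 2^-1 + 2^-1 = 1 :> R by field.
  by rewrite scale1r.
apply: unitmx_inj => x; rewrite mul_col_mx diagonal_alE diagonal_beE => /eqP.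
rewrite col_mx_eq0 scaler_eq0 invr_eq0 (negPf two) /= => /andP[/eqP a0].
rewrite subr_eq0 => /eqP dE; rewrite -[x]vsubmxK dE.
suff -> : usubmx x = 0 by rewrite col_mx0.
move: a0; rewrite dE => /(congr1 (mulmx (invmx Omega0^T))).
rewrite mulKmx ?unitmx_tr ?Omega0_unit // mulmx0 -mulr2n -scaler_nat => /eqP.
by rewrite scaler_eq0 (negPf two) => /eqP.
Qed.

Definition graph_map (A : 'M[R]_(n + n)) (x : 'cV[R]_(n + n)) := col_mx x (A *m x).

Lemma graph_map_linear A : linear (graph_map A).
Proof.
move=> c x y; rewrite /graph_map mulmxDr -scalemxAr.
by rewrite scale_col_mx add_col_mx.
Qed.

HB.instance Definition _ A := GRing.isLinear.Build R _ _ _ (graph_map A) (graph_map_linear A).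

Lemma mem_mxgraph A (v : 'cV[R]_((n + n) + (n + n))) :
  v \in mxgraph A <-> dsubmx v = A *m usubmx v.
Proof.
have E u : linfun (fun x : 'cV[R]_(n + n) => col_mx x (A *m x)) u = col_mx u (A *m u).
  exact: (lfunE (graph_map A)).
split=> [/memv_imgP[u _ ->]|dE]; first by rewrite E col_mxKd col_mxKu.
by apply/memv_imgP; exists (usubmx v); rewrite ?memvf // E -dE vsubmxK.
Qed.

Lemma diagonal_mxgraph : diagonal_space = mxgraph (1%:M : 'M[R]_(n + n)).
Proof.
rewrite /diagonal_space /mxgraph; congr (limg (linfun _)).
by apply/funext => x; rewrite mul1mx.
Qed.

Lemma mem_diagonal (v : 'cV[R]_((n + n) + (n + n))) :
  v \in diagonal_space <-> diagonal_be *m v = 0.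
Proof.
rewrite diagonal_beE diagonal_mxgraph; split=> [/mem_mxgraph ->|/eqP].
  by rewrite mul1mx subrr.
by rewrite subr_eq0 => /eqP dE; apply/mem_mxgraph; rewrite mul1mx.
Qed.

Lemma shear_graph (B : 'M[R]_n) :
  mxgraph (shear B) = graph_space diagonal_al diagonal_be (block_mx (- B) 0 0 0).
Proof.
have OE (x y : 'cV[R]_n) : Omega0^T *m col_mx x y = col_mx (- y) x.
  rewrite tr_Omega0 /Omega0 opp_block_mx mul_block_col !oppr0 opprK !mul0mx.
  by rewrite mulNmx !mul1mx add0r addr0.
have half2 (y : 'cV[R]_n) : 2^-1 *: (y + y) = y.
  have h : 2^-1 + 2^-1 = 1 :> R by field.
  by rewrite scalerDr -scalerDl h scale1r.
have SE (x y x' y' : 'cV[R]_n) : block_mx (- B) 0 0 0 *m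
   (2^-1 *: (Omega0^T *m (col_mx x y + col_mx x' y'))) = col_mx (B *m (2^-1 *: (y + y'))) 0.
  rewrite add_col_mx OE scale_col_mx mul_block_col !mul0mx !addr0.
  by rewrite scalerN mulmxN mulNmx opprK.
apply/vspaceP => v; apply/idP/idP => [/mem_mxgraph|/mem_graph_space].
  move=> dE; apply/mem_graph_space; rewrite diagonal_alE diagonal_beE dE.
  rewrite -[usubmx v]vsubmxK shearE SE half2 opp_col_mx add_col_mx subrr.
  by rewrite addrAC subrr add0r.
rewrite diagonal_alE diagonal_beE => h; apply/mem_mxgraph; move: h.
set z := usubmx v; set z' := dsubmx v.
rewrite -[z]vsubmxK -[z']vsubmxK SE opp_col_mx add_col_mx shearE => /eq_col_mx[xE yE].
have yy : dsubmx z' = dsubmx z by apply/eqP; rewrite -subr_eq0 yE.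
rewrite yy; congr (col_mx _ _); move: xE; rewrite yy half2 => <-.
by rewrite addrC subrK.
Qed.

End Shears.

Theorem proposition60 (R : realType) (n : nat) (B : R -> 'M[R]_n)
    (B_continuous : {within `[0, 1], continuous B})
    (B_symmetric : forall t : R, t \in `[0, 1] -> (B t)^T = B t) :
  mu_RS (fun t => shear (B t)) = mu_RS2 (fun t => shear (B t)).
Proof.
have Bc (t : R) : t \in `[0, 1] -> mx_cvg (within `[0, 1]%classic (nbhs t)) B (B t).
  move=> t01 i j.
  have h : B x @[x --> within `[0, 1]%classic (nbhs t)] --> B t.
    by move/subspace_continuousP: B_continuous; exact.
  exact: (cvg_comp B (fun M : 'M[R]_n => M i j) h (@coord_continuous R n n i j _)).
have BNc (t : R) : t \in `[0, 1] ->
    mx_cvg (within `[0, 1]%classic (nbhs t)) (fun x => - B x) (- B t).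
  by move=> t01 i j; rewrite mxE; under eq_fun do rewrite mxE; apply: cvgN; exact: Bc.
have BNsym (t : R) : t \in `[0, 1] -> (- B t)^T = - B t.
  by move=> t01; rewrite linearN /= B_symmetric.
have BNsym' (t : R) : t \in `[0, 1] ->
    (block_mx (- B t) 0 0 (0 : 'M[R]_n))^T = block_mx (- B t) 0 0 0.
  by move=> t01; rewrite tr_block_mx !trmx0 BNsym.
have z01 : (0 : R) \in `[0, 1] by rewrite in_itv /= lexx ler01.
have i01 : (1 : R) \in `[0, 1] by rewrite in_itv /= lexx ler01.
rewrite /mu_RS2 (rs_index_graph darboux_vertical mem_vertical BNsym BNc); last first.
  by move=> t _; exact: shear_vertical.
rewrite /mu_RS (rs_index_graph darboux_diagonal mem_diagonal BNsym'); last 2 first.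
- by move=> t t01; apply: mx_cvg_block; [exact: BNc | exact: mx_cvg_cst..].
- by move=> t _; exact: shear_graph.
have sigE (t : R) : t \in `[0, 1] ->
    mx_signature (block_mx (- B t) 0 0 (0 : 'M[R]_n)) = mx_signature (- B t).
  move=> t01; rewrite (mx_signature_block (BNsym t t01) (trmx0 _ _ _)).
  by rewrite mx_signature0 addr0.
by rewrite (sigE 1 i01) (sigE 0 z01).
Qed.
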